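(* Let $G$ be a SIN topological group whose strongly continuous unitary representations separate points and closed sets. If $G$ is amenable and has strong property $(T)$, then $G$ is precompact.
   Context: All topological groups are Hausdorff. A topological group is SIN if conjugation-invariant neighbourhoods of the identity form a neighbourhood basis at the identity (equivalently, the left and right uniform structures coincide). ''Continuous unitary representations separate points and closed sets'' means that the topology of $G$ is determined by its strongly continuous unitary representations; equivalently, $G$ embeds as a topological subgroup into $U(\mathcal H)$ with the strong operator topology for some Hilbert space $\mathcal H$. $G$ is amenable if every continuous action of $G$ on a (non-empty) compact Hausdorff space admits an invariant regular Borel probability measure; equivalently, there is a left-invariant mean on the space of bounded right uniformly continuous functions on $G$. A subset $Q\subseteq G$ is a Kazhdan set if there is $\varepsilon>0$ such that every strongly continuous unitary representation $\pi$ of $G$ that has a unit vector $\xi$ with $\|\xi-\pi_g\xi\|<\varepsilon$ for all $g\in Q$ has an invariant unit vector. $G$ has strong property $(T)$ if it has a finite Kazhdan set. $G$ is precompact if its completion (with respect to the two-sided uniformity) is compact, i.e. $G$ is topologically isomorphic to a subgroup of a compact group. *)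

(* Defs.v *)
From HB Require Import structures.
From mathcomp Require Import all_boot all_order all_algebra.
From mathcomp Require Import all_classical all_reals all_analysis.
From mathcomp Require Export complex.

Set Implicit Arguments.
Unset Strict Implicit.
Unset Printing Implicit Defensive.

Import Order.TTheory GRing.Theory Num.Theory.
Import numFieldNormedType.Exports.

Local Open Scope classical_set_scope.
Local Open Scope complex_scope.
Local Open Scope ring_scope.

(* Not assumed Hausdorff: separation is a separate hypothesis. *)
HB.mixin Record isTopologicalGroup G of Group G & Topological G := {
  mulg_continuous : continuous (fun p : G * G => (p.1 * p.2)%g);
  invg_continuous : continuous (fun x : G => x^-1%g)
}.

#[short(type="topologicalGroupType")]
HB.structure Definition TopologicalGroup :=
  {G of Group G & Topological G & isTopologicalGroup G}.

(* The norm of a normed module over R[i] takes its values in R[i]. The inner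
   product is linear in its first argument. *)
HB.mixin Record isHilbert (R : realType) H of CompleteNormedModule R[i] H := {
  hdot : {dot H for (@conjc R)};
  hdot_norm : forall x : H, `|x| ^+ 2 = hdot x x
}.

#[short(type="hilbertType")]
HB.structure Definition Hilbert (R : realType) :=
  {H of CompleteNormedModule R[i] H & isHilbert R H}.

Record unitary (R : realType) (H : hilbertType R) (u : H -> H) : Prop :=
  Unitary {
    unitary_linear : linear u;
    unitary_hdot : forall x y : H, hdot (u x) (u y) = hdot x y;
    unitary_bij : bijective u
  }.

(* The strong operator topology is the topology of pointwise convergence for
   the norm topology of H. *)
Record unitaryRep (R : realType) (G : topologicalGroupType)
    (H : hilbertType R) := UnitaryRep {
  rep_fun :> G -> {ptws H -> H};
  rep_unitary : forall g : G, unitary (rep_fun g);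
  repM : forall (g h : G) (x : H), rep_fun (g * h)%g x = rep_fun g (rep_fun h x);
  rep_continuous : continuous rep_fun
}.

Definition SIN (G : topologicalGroupType) : Prop :=
  forall U : set G, nbhs 1%g U ->
    exists V : set G, [/\ nbhs 1%g V, V `<=` U &
      forall g x : G, V x -> V (x ^ g)%g].

(* This is separate_points_from_closed for the family of all strongly
   continuous unitary representations of G. It is unfolded because that family
   is indexed by all Hilbert spaces, hence by a type in a larger universe.
   Closures are taken in the space of all maps H -> H; as the strong operator
   topology is induced from it, this makes no difference at a unitary. *)
Definition unitary_reps_separate (R : realType) (G : topologicalGroupType) :
    Prop :=
  forall (C : set G) (g : G), closed C -> ~ C g ->
    exists (H : hilbertType R) (pi : unitaryRep G H),
      ~ closure (pi @` C) (pi g).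

Record continuous_action (G : topologicalGroupType) (X : topologicalType) :=
  ContinuousAction {
    action_fun :> G -> X -> X;
    action1 : forall x : X, action_fun 1%g x = x;
    actionM : forall (g h : G) (x : X),
      action_fun (g * h)%g x = action_fun g (action_fun h x);
    action_continuous : continuous (fun p : G * X => action_fun p.1 p.2)
  }.

Definition borel (X : ptopologicalType) : measurableType _ :=
  g_sigma_algebraType (@open X).

Definition regular_measure (R : realType) (X : ptopologicalType)
    (mu : set (borel X) -> \bar R) : Prop :=
  forall A : set (borel X), measurable A ->
    mu A = ereal_inf [set mu U | U in [set U : set X | open U /\ A `<=` U]] /\
    mu A = ereal_sup [set mu K | K in [set K : set X | compact K /\ K `<=` A]].

(* A nonempty space is one that can be given a base point, i.e. a
   ptopologicalType; the base point plays no further role. *)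
Definition amenable (R : realType) (G : topologicalGroupType) : Prop :=
  forall (X : ptopologicalType) (a : continuous_action G X),
    compact [set: X] -> hausdorff_space X ->
    exists mu : probability (borel X) R,
      regular_measure mu /\
      forall (g : G) (A : set (borel X)), measurable A ->
        mu (a g @^-1` A) = mu A.

Definition Kazhdan_set (R : realType) (G : topologicalGroupType) (Q : set G) :
    Prop :=
  exists2 eps : R, 0 < eps &
    forall (H : hilbertType R) (pi : unitaryRep G H),
      (exists2 xi : H, `|xi| = 1 &
         forall g, Q g -> `|xi - pi g xi| < eps%:C) ->
      exists2 eta : H, `|eta| = 1 & forall g : G, pi g eta = eta.

Definition strong_property_T (R : realType) (G : topologicalGroupType) : Prop :=
  exists2 Q : set G, finite_set Q & Kazhdan_set R Q.

(* f is a topological isomorphism of G onto its image, a subgroup of K: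
   f is an injective homomorphism and the topology of G is the one that f
   induces from K. *)
Definition topological_group_embedding (G K : topologicalGroupType)
    (f : G -> K) : Prop :=
  [/\ {morph f : x y / (x * y)%g}, injective f &
      @open G = @open (initial_topology f)].

Definition precompact_group (G : topologicalGroupType) : Prop :=
  exists (K : topologicalGroupType) (f : G -> K),
    [/\ hausdorff_space K, compact [set: K] & topological_group_embedding f].

(* Main.v *)
(* Call a vector of a unitary representation pi compact when its orbit is totally
   bounded. If all vectors of all representations are compact, then G embeds into
   a compact group of isometries of the orbit closures. Otherwise some unit vector
   z is orthogonal to all compact vectors, and G acts by conjugation on the Hilbert
   space of Hilbert-Schmidt operators with range orthogonal to them. An invariant
   operator T is compact and commutes with pi, so its range consists of compact
   vectors and T = 0. The finite Kazhdan set then gives a spectral gap, hence for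
   S the symmetrized Kazhdan set there are lam < 1 and positive operators X, bounded
   below at finitely many prescribed vectors of the orbit of z, such that the
   average of s X s^-1 over s in S is at most lam X. Since log is operator monotone
   and operator concave, the operators s (log X) s^-1 - log X are bounded uniformly
   in X, and their average over S is at most log lam < 0. Evaluating at the orbit
   of z gives increments phi_s(g) = L(s g) - L(g) that are bounded and, by the SIN
   property, uniformly continuous on both sides; limits of such families form a
   compact G-space. The mean of phi_s under an invariant probability measure is
   opposite to that of its inverse, so their sum is zero, against the negative
   bound on the average. The logarithm is replaced by a finite sum of Moreau
   envelopes of the quadratic form of X. *)
From HB Require Import structures.
Require Import Defs.
From mathcomp Require Import all_boot all_order all_algebra.
From mathcomp Require Import all_classical all_reals all_analysis.
From mathcomp Require Import measurable_realfun.
From mathcomp Require Import complex ring lra.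

Set Implicit Arguments.
Unset Strict Implicit.
Unset Printing Implicit Defensive.

Import Order.TTheory GRing.Theory Num.Theory.
Import numFieldNormedType.Exports.

Local Open Scope classical_set_scope.
Local Open Scope complex_scope.
Local Open Scope ring_scope.

Local Notation Re := complex.Re.
Local Notation Im := complex.Im.
Local Notation normc := ComplexField.Normc.normc.

(** * Hilbert spaces with real-valued norm and inner product *)

(** The operator X depends on the finite set of orbit points at which it is bounded below, and
    neither its norm nor its lower bound is controlled as that set grows. Hence there is no limit of
    the functions L, and the compact space consists of increments: their bound and the negative
    bound on their sum over S do not see these constants. A logarithm is what makes a rescaling of X
    disappear. Three of its properties are used: monotonicity, concavity, and a drop of fixed size
    when X is replaced by lam X. On a scalar 0 < x <= 1 the substitute is the sum over k < m of x /
    (x + lam^k), which is m + log x / log (1 / lam) up to a bounded error once lam^m <= x.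
    Hilbert-Schmidt operators enter because property (T) speaks of unitary representations: without
    invariant vectors it makes averaging over S a strict contraction. Dividing this average by a lam
    slightly larger than its norm still leaves a contraction, whose fixed point equation with a
    positive source term produces X. *)

Section RealHilbert.
Variables (R : realType) (H : hilbertType R).
Implicit Types (x y z : H) (a : R[i]) (r : R).

Definition hnorm x : R := Re `|x|.
Definition rdot x y : R := Re (hdot x y).

Lemma norm_hnorm x : `|x| = (hnorm x)%:C.
Proof. by rewrite /hnorm RRe_real // ger0_real. Qed.

Lemma hnorm_ge0 x : 0 <= hnorm x.
Proof. by rewrite -ler0c -norm_hnorm. Qed.

Lemma hnorm_eq0 x : hnorm x = 0 -> x = 0.
Proof. by move=> x0; apply/normr0_eq0; rewrite norm_hnorm x0. Qed.

Lemma hnorm0 : hnorm 0 = 0.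
Proof. by rewrite /hnorm normr0. Qed.

Lemma hnorm_gt0 x : x != 0 -> 0 < hnorm x.
Proof.
by rewrite lt_def hnorm_ge0 andbT => /eqP x0; apply/eqP => /hnorm_eq0.
Qed.

Lemma hnormN x : hnorm (- x) = hnorm x.
Proof. by rewrite /hnorm normrN. Qed.

Lemma hnormB x y : hnorm (x - y) = hnorm (y - x).
Proof. by rewrite -hnormN opprB. Qed.

Lemma hnormD x y : hnorm (x + y) <= hnorm x + hnorm y.
Proof. by rewrite -lecR rmorphD /= -!norm_hnorm ler_normD. Qed.

Lemma hnormDB x y z : hnorm (x - z) <= hnorm (x - y) + hnorm (y - z).
Proof. by rewrite (le_trans _ (hnormD _ _)) // addrA subrK. Qed.

Lemma hnormZ a x : hnorm (a *: x) = normc a * hnorm x.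
Proof. by apply: complexI; rewrite rmorphM /= -!norm_hnorm normrZ. Qed.

Lemma hnormZr r x : hnorm (r%:C *: x) = `|r| * hnorm x.
Proof. by rewrite hnormZ /= expr0n addr0 sqrtr_sqr. Qed.

Lemma hdotDl x y z : hdot (x + y) z = hdot x z + hdot y z.
Proof. by rewrite linearDl. Qed.
Lemma hdotZl a x y : hdot (a *: x) y = a * hdot x y.
Proof. by rewrite linearZl_LR. Qed.
Lemma hdotZr a x y : hdot x (a *: y) = conjc a * hdot x y.
Proof. by rewrite linearZr_LR. Qed.
Lemma hdotC x y : hdot x y = conjc (hdot y x).
Proof. by have := hermC (@hdot R H) x y; rewrite expr0 mul1r. Qed.

Lemma hdotNl x y : hdot (- x) y = - hdot x y.
Proof. by rewrite -scaleN1r hdotZl mulN1r. Qed.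
Lemma hdotBl x y z : hdot (x - y) z = hdot x z - hdot y z.
Proof. by rewrite hdotDl hdotNl. Qed.
Lemma hdot0l x : hdot 0 x = 0.
Proof. by rewrite -(scale0r (0 : H)) hdotZl mul0r. Qed.

Lemma hdot_suml I (s : seq I) (F : I -> H) y :
  hdot (\sum_(i <- s) F i) y = \sum_(i <- s) hdot (F i) y.
Proof.
elim: s => [|i s IH]; first by rewrite !big_nil hdot0l.
by rewrite !big_cons hdotDl IH.
Qed.

Lemma hdotxx x : hdot x x = (hnorm x ^+ 2)%:C.
Proof. by rewrite -hdot_norm norm_hnorm rmorphXn. Qed.

Lemma rdotxx x : rdot x x = hnorm x ^+ 2.
Proof. by rewrite /rdot hdotxx. Qed.

Lemma rdotC x y : rdot x y = rdot y x.
Proof. by rewrite /rdot hdotC; case: (hdot y x). Qed.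
Lemma rdotDl x y z : rdot (x + y) z = rdot x z + rdot y z.
Proof. by rewrite /rdot hdotDl; case: (hdot x z) (hdot y z) => [? ?] [? ?]. Qed.
Lemma rdotDr x y z : rdot x (y + z) = rdot x y + rdot x z.
Proof. by rewrite rdotC rdotDl !(rdotC x). Qed.
Lemma rdotZl r x y : rdot (r%:C *: x) y = r * rdot x y.
Proof. by rewrite /rdot hdotZl; case: (hdot x y) => p q /=; rewrite mul0r subr0. Qed.
Lemma rdotZr r x y : rdot x (r%:C *: y) = r * rdot x y.
Proof. by rewrite rdotC rdotZl rdotC. Qed.
Lemma rdotNl x y : rdot (- x) y = - rdot x y.
Proof. by rewrite /rdot hdotNl; case: (hdot x y). Qed.
Lemma rdotNr x y : rdot x (- y) = - rdot x y.
Proof. by rewrite rdotC rdotNl rdotC. Qed.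
Lemma rdotBl x y z : rdot (x - y) z = rdot x z - rdot y z.
Proof. by rewrite rdotDl rdotNl. Qed.
Lemma rdot0l x : rdot 0 x = 0.
Proof. by rewrite /rdot hdot0l. Qed.
Lemma rdot_il x y : rdot ('i *: x) y = - Im (hdot x y).
Proof. by rewrite /rdot hdotZl; case: (hdot x y) => p q /=; rewrite mul0r mul1r sub0r. Qed.

Lemma hdotE x y : hdot x y = rdot x y +i* - rdot ('i *: x) y.
Proof. by rewrite rdot_il opprK /rdot; case: (hdot x y). Qed.

Lemma hnorm2D x y : hnorm (x + y) ^+ 2 = hnorm x ^+ 2 + hnorm y ^+ 2 + 2 * rdot x y.
Proof. by rewrite -!rdotxx !rdotDl !rdotDr (rdotC y x); ring. Qed.

Lemma hnorm2B x y : hnorm (x - y) ^+ 2 = hnorm x ^+ 2 + hnorm y ^+ 2 - 2 * rdot x y.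
Proof. by rewrite hnorm2D hnormN rdotNr mulrN. Qed.

Lemma parallelogram x y :
  hnorm (x + y) ^+ 2 + hnorm (x - y) ^+ 2 = 2 * hnorm x ^+ 2 + 2 * hnorm y ^+ 2.
Proof. by rewrite hnorm2B hnorm2D; ring. Qed.

Lemma rdot_le x y : rdot x y <= hnorm x * hnorm y.
Proof.
have [y0|yN0] := eqVneq (hnorm y) 0.
  by rewrite (hnorm_eq0 y0) hnorm0 mulr0 rdotC rdot0l.
have [x0|xN0] := eqVneq (hnorm x) 0.
  by rewrite (hnorm_eq0 x0) hnorm0 mul0r rdot0l.
have xp : 0 < hnorm x by rewrite lt_def xN0 hnorm_ge0.
have yp : 0 < hnorm y by rewrite lt_def yN0 hnorm_ge0.
have := sqr_ge0 (hnorm ((hnorm y)%:C *: x - (hnorm x)%:C *: y)).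
rewrite hnorm2B !hnormZr rdotZl rdotZr !ger0_norm ?hnorm_ge0 // => h.
have {h} : 0 <= (hnorm x * hnorm y) * (hnorm x * hnorm y - rdot x y) by nra.
by rewrite pmulr_rge0 ?mulr_gt0 // subr_ge0.
Qed.

Lemma normc_sqr a : normc a ^+ 2 = Re a ^+ 2 + Im a ^+ 2.
Proof. by case: a => p q /=; rewrite sqr_sqrtr // addr_ge0 ?sqr_ge0. Qed.

Lemma normc_ge0 a : 0 <= normc a.
Proof. by case: a => p q; rewrite sqrtr_ge0. Qed.

Lemma normcJ a : normc (conjc a) = normc a.
Proof. by case: a => p q /=; rewrite sqrrN. Qed.

Lemma mulJc a : conjc a * a = (normc a ^+ 2)%:C.
Proof.
rewrite normc_sqr; case: a => p q; apply/eqP.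
by rewrite eq_complex /=; apply/andP; split; apply/eqP; ring.
Qed.

Lemma cauchy_schwarz x y : normc (hdot x y) <= hnorm x * hnorm y.
Proof.
(* Multiplying [x] by the conjugate of [hdot x y] makes the product with [y] equal to
   [normc (hdot x y) ^+ 2], so the real inequality suffices. *)
have := rdot_le (conjc (hdot x y) *: x) y.
rewrite /rdot hdotZl mulJc /= hnormZ normcJ => h.
have [-> | n0] := eqVneq (normc (hdot x y)) 0; first by rewrite mulr_ge0 ?hnorm_ge0.
have np : 0 < normc (hdot x y) by rewrite lt_def n0 normc_ge0.
by rewrite -(ler_pM2l np) -expr2 (le_trans h) // mulrA.
Qed.

Lemma abs_rdot_le x y : `|rdot x y| <= hnorm x * hnorm y.
Proof. by rewrite ler_norml rdot_le andbT lerNl -rdotNl (le_trans (rdot_le _ _)) ?hnormN. Qed.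

Lemma cvg_hnormP (F : set_system H) {FF : Filter F} x :
  F --> x <-> forall e : R, 0 < e -> \forall y \near F, hnorm (x - y) < e.
Proof.
split.
  move=> /cvgrPdist_lt h e e0; have := h e%:C; rewrite ltcR => /(_ e0).
  by apply: filterS => y; rewrite norm_hnorm ltcR.
move=> h; apply/cvgrPdist_lt => e e0.
have e_real : e = (Re e)%:C by rewrite RRe_real // gtr0_real.
rewrite e_real ltcR in e0; apply: filterS (h _ e0) => y.
by rewrite norm_hnorm e_real ltcR.
Qed.

Lemma hilbert_cauchy (F : set_system H) {FF : ProperFilter F} :
  (forall e : R, 0 < e -> exists2 A, F A & forall x y, A x -> A y -> hnorm (x - y) < e) ->
  exists x : H, F --> x.
Proof.
move=> hF; suff /cvg_ex : cvg F by [].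
apply: cauchy_cvg; apply/cauchy_ballP => e e0.
have e_real : e = (Re e)%:C by rewrite RRe_real // gtr0_real.
have [|A FA hA] := hF (Re e); first by rewrite -ltcR -e_real.
near_simpl; exists (A, A) => // -[x y] [/= Ax Ay].
by rewrite -ball_normE /= norm_hnorm e_real ltcR; apply: hA.
Qed.

End RealHilbert.

(** * Hilbert-Schmidt operators *)

Section LinearMaps.
Variables (R : realType) (H : hilbertType R).
Implicit Types (T : H -> H) (x y : H).

Lemma linear_map0 T : linear T -> T 0 = 0.
Proof. by move=> lT; have := lT (-1) 0 0; rewrite scaler0 addr0 scaleN1r addNr. Qed.

Lemma linear_mapD T x y : linear T -> T (x + y) = T x + T y.
Proof. by move=> lT; have := lT 1 x y; rewrite !scale1r. Qed.

Lemma linear_mapZ T a x : linear T -> T (a *: x) = a *: T x.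
Proof. by move=> lT; rewrite -[a *: x]addr0 lT linear_map0 // addr0. Qed.

Lemma linear_mapN T x : linear T -> T (- x) = - T x.
Proof. by move=> lT; rewrite -scaleN1r linear_mapZ // scaleN1r. Qed.

Lemma linear_mapB T x y : linear T -> T (x - y) = T x - T y.
Proof. by move=> lT; rewrite linear_mapD // linear_mapN. Qed.

Lemma linear_map_sum T I (s : seq I) (a : I -> R[i]) (F : I -> H) : linear T ->
  T (\sum_(i <- s) a i *: F i) = \sum_(i <- s) a i *: T (F i).
Proof.
move=> lT; elim: s => [|i s IH]; first by rewrite !big_nil linear_map0.
by rewrite !big_cons lT IH.
Qed.

Lemma rdotZ_adj a x y : rdot x (a *: y) = rdot (conjc a *: x) y.
Proof. by rewrite /rdot hdotZr hdotZl. Qed.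

Lemma rdot_suml I (s : seq I) (F : I -> H) y :
  rdot (\sum_(i <- s) F i) y = \sum_(i <- s) rdot (F i) y.
Proof.
elim: s => [|i s IH]; first by rewrite !big_nil rdot0l.
by rewrite !big_cons rdotDl IH.
Qed.

Lemma rdot_sumr I (s : seq I) (F : I -> H) x :
  rdot x (\sum_(i <- s) F i) = \sum_(i <- s) rdot x (F i).
Proof. by rewrite rdotC rdot_suml; apply: eq_bigr => i _; rewrite rdotC. Qed.

End LinearMaps.

Section Orthonormal.
Variables (R : realType) (H : hilbertType R).
Implicit Types (s t l : seq H) (x y e f : H).

Definition onseq s : Prop :=
  uniq s /\ forall e f, e \in s -> f \in s -> hdot e f = (e == f)%:R.

Definition proj s x : H := \sum_(e <- s) hdot x e *: e.

Lemma proj_linear s : linear (proj s).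
Proof.
move=> a x y; rewrite /proj scaler_sumr -big_split /=.
by apply: eq_bigr => e _; rewrite hdotDl hdotZl scalerDl scalerA.
Qed.

Lemma hdot_proj s x e : onseq s -> e \in s -> hdot (proj s x) e = hdot x e.
Proof.
move=> [us ons] es; rewrite /proj hdot_suml (bigD1_seq e) //= hdotZl (ons e e) //.
rewrite eqxx mulr1 big_seq_cond big1 ?addr0 // => f /andP[fs fe].
by rewrite hdotZl (ons f e) // (negbTE fe) mulr0.
Qed.

Lemma proj_id s e : onseq s -> e \in s -> proj s e = e.
Proof.
move=> [us ons] es; rewrite /proj (bigD1_seq e) //= ons // eqxx scale1r.
rewrite big_seq_cond big1 ?addr0 // => f /andP[fs fe].
by rewrite ons // eq_sym (negbTE fe) scale0r.
Qed.

Lemma hnorm2_proj s x : onseq s ->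
  hnorm (proj s x) ^+ 2 = \sum_(e <- s) normc (hdot x e) ^+ 2.
Proof.
move=> ons; rewrite -rdotxx {2}/proj rdot_sumr big_seq [RHS]big_seq.
apply: eq_bigr => e es; rewrite rdotZ_adj /rdot hdotZl hdot_proj //.
by rewrite mulJc.
Qed.

Lemma bessel s x : onseq s -> \sum_(e <- s) normc (hdot x e) ^+ 2 <= hnorm x ^+ 2.
Proof.
move=> ons; rewrite -hnorm2_proj //.
have : rdot (x - proj s x) (proj s x) = 0.
  rewrite {2}/proj rdot_sumr big_seq big1 // => e es.
  by rewrite rdotZ_adj /rdot hdotZl hdotBl hdot_proj // subrr mulr0.
move=> o; have := hnorm2D (x - proj s x) (proj s x).
by rewrite subrK o mulr0 addr0 => ->; rewrite lerDr sqr_ge0.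
Qed.

Lemma onseq1 e : hnorm e = 1 -> onseq [:: e].
Proof.
move=> e1; split=> // x y; rewrite !inE => /eqP-> /eqP->.
by rewrite hdotxx e1 expr1n eqxx.
Qed.

(** The equation [proj t x = x] expresses membership in the span of [t]. A vector outside the
    current span contributes its normalized remainder [u]. *)
Lemma gram_schmidt l : exists t, onseq t /\ forall x, x \in l -> proj t x = x.
Proof.
elim: l => [|x l [t [ont ht]]]; first by exists [::]; split; first by split.
have [xt|xt] := eqVneq (proj t x) x.
  by exists t; split=> // z; rewrite inE => /orP[/eqP->|/ht].
pose y := x - proj t x; pose u := (hnorm y)^-1%:C *: y.
have yp : 0 < hnorm y by apply: hnorm_gt0; rewrite subr_eq0 eq_sym.
have yt e : e \in t -> hdot y e = 0.
  by move=> et; rewrite hdotBl hdot_proj // subrr.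
have ut e : e \in t -> hdot u e = 0 by move=> et; rewrite hdotZl yt // mulr0.
have tu e : e \in t -> hdot e u = 0 by move=> et; rewrite hdotC ut // conjc0.
have uu : hdot u u = 1.
  by rewrite hdotxx hnormZr ger0_norm ?invr_ge0 ?hnorm_ge0 // mulVf ?gt_eqF // expr1n.
have hu z : proj t z = z -> hdot z u = 0.
  by move=> <-; rewrite hdot_suml big_seq big1 // => e et; rewrite hdotZl tu // mulr0.
have projE z : proj (u :: t) z = hdot z u *: u + proj t z by rewrite /proj big_cons.
have uNt : u \notin t by apply/negP => /ut; rewrite uu => /eqP; rewrite oner_eq0.
exists (u :: t); split.
  split; first by rewrite /= uNt; case: ont.
  move=> e f; rewrite !inE => /orP[/eqP->|et] /orP[/eqP->|ft].
  - by rewrite uu eqxx.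
  - by rewrite ut //; case: eqP uNt => // ->; rewrite ft.
  - by rewrite tu //; case: eqP uNt => // <-; rewrite et.
  - by case: ont => _ ->.
move=> z; rewrite inE projE => /orP[/eqP->|/ht zt]; last by rewrite hu // scale0r add0r.
have -> : hdot x u = (hnorm y)%:C.
  rewrite -{1}(subrK (proj t x) x) -/y hdotDl (hu (proj t x)); last first.
    by rewrite {1}/proj /proj; apply: eq_big_seq => e et; rewrite -/(proj t x) hdot_proj.
  rewrite addr0 hdotZr hdotxx conjc_real -rmorphM /=; congr (_ %:C).
  by rewrite expr2 mulrA mulVf ?gt_eqF // mul1r.
by rewrite scalerA -rmorphM /= divff ?gt_eqF // scale1r /y subrK.
Qed.

End Orthonormal.

Section HSforms.
Variables (R : realType) (H : hilbertType R).
Implicit Types (s t l : seq H) (x y e f : H) (S T : H -> H).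

Definition hs_pdot s S T : R := \sum_(e <- s) rdot (S e) (T e).
Definition hs_psum s T : R := hs_pdot s T T.

Lemma hs_psumE s T : hs_psum s T = \sum_(e <- s) hnorm (T e) ^+ 2.
Proof. by apply: eq_bigr => e _; rewrite rdotxx. Qed.

Lemma hs_psum_ge0 s T : 0 <= hs_psum s T.
Proof. by rewrite hs_psumE sumr_ge0 // => e _; rewrite sqr_ge0. Qed.

Lemma hs_pdotC s S T : hs_pdot s S T = hs_pdot s T S.
Proof. by apply: eq_bigr => e _; rewrite rdotC. Qed.

Lemma hs_pdotDl s S S' T : hs_pdot s (S + S') T = hs_pdot s S T + hs_pdot s S' T.
Proof. by rewrite -big_split; apply: eq_bigr => e _; rewrite rdotDl. Qed.

Lemma hs_pdotZl s r S T : hs_pdot s (r%:C *: S) T = r * hs_pdot s S T.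
Proof. by rewrite mulr_sumr; apply: eq_bigr => e _; rewrite rdotZl. Qed.

Lemma hs_pdotii s S T : hs_pdot s ('i *: S) ('i *: T) = hs_pdot s S T.
Proof.
apply: eq_bigr => e _; rewrite -[in RHS](scale1r (S e)) rdotZ_adj scalerA.
by congr (rdot (_ *: _) _); apply/eqP; rewrite eq_complex /=; apply/andP; split; apply/eqP; ring.
Qed.

Lemma hs_pdot_polar s S T : hs_pdot s S T = (hs_psum s (S + T) - hs_psum s (S - T)) / 4.
Proof.
rewrite /hs_psum /hs_pdot -sumrB mulr_suml; apply: eq_bigr => e _.
by rewrite !rdotxx hnorm2D hnorm2B; field.
Qed.

Lemma hs_psumD s S T : hs_psum s (S + T) = hs_psum s S + hs_psum s T + 2 * hs_pdot s S T.
Proof.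
rewrite /hs_psum /hs_pdot mulr_sumr -!big_split; apply: eq_bigr => e _ /=.
by rewrite !rdotxx hnorm2D.
Qed.

Lemma hs_psumB s S T : hs_psum s (S - T) = hs_psum s S + hs_psum s T - 2 * hs_pdot s S T.
Proof.
rewrite /hs_psum /hs_pdot mulr_sumr -!big_split -sumrB; apply: eq_bigr => e _ /=.
by rewrite !rdotxx hnorm2B.
Qed.

(* Independence of the orthonormal family, in the form that gives both the
   monotonicity of [hs_psum] and the approximation by finite rank operators. *)
Lemma hs_pdot_proj s t S T : linear S -> linear T ->
  (forall e, e \in s -> proj t e = e) -> hs_pdot t S (T \o proj s) = hs_pdot s S T.
Proof.
move=> lS lT st; rewrite /hs_pdot.
under eq_bigr do rewrite /= /proj linear_map_sum // rdot_sumr.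
rewrite exchange_big big_seq [RHS]big_seq; apply: eq_bigr => e es.
rewrite -[in S e](st e es) /proj linear_map_sum // rdot_suml.
by apply: eq_bigr => f _; rewrite rdotZ_adj -hdotC.
Qed.

(** Pythagoras: both the product of [T] with [T \o proj s] and the square of [T \o proj s] reduce to
    [hs_psum s T]. *)
Lemma hs_psum_sub_proj s t T : linear T -> onseq s ->
  (forall e, e \in s -> proj t e = e) ->
  hs_psum t (T - (T \o proj s)) = hs_psum t T - hs_psum s T.
Proof.
move=> lT ons st.
have lP : linear (T \o proj s) by move=> a x y /=; rewrite proj_linear lT.
have e1 : hs_pdot t T (T \o proj s) = hs_psum s T by apply: hs_pdot_proj.
have e2 : hs_psum t (T \o proj s) = hs_psum s T.
  transitivity (hs_pdot s (T \o proj s) T); first exact: hs_pdot_proj.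
  by rewrite /hs_psum /hs_pdot big_seq [RHS]big_seq; apply: eq_bigr => e es /=; rewrite proj_id.
by rewrite hs_psumB e1 e2; ring.
Qed.

Lemma hs_psum_le s t T : linear T -> onseq s ->
  (forall e, e \in s -> proj t e = e) -> hs_psum s T <= hs_psum t T.
Proof.
by move=> lT ons st; rewrite -subr_ge0 -(hs_psum_sub_proj lT ons st) hs_psum_ge0.
Qed.

(* Along this filter [hs_psum s T] converges to the squared Hilbert-Schmidt norm
   of [T], by monotonicity (lemma hs_psum_le); the inner product is defined
   below as the corresponding limit. *)
Definition onfilter : set_system (seq H) := filter_from setT
  (fun l => [set t | onseq t /\ forall x, x \in l -> proj t x = x]).

Global Instance onfilter_filter : ProperFilter onfilter.
Proof.
apply: filter_from_proper.
  apply: filter_fromT_filter; first by exists [::].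
  move=> l l'; exists (l ++ l') => t [ont h]; split; split=> // x xl; apply: h.
    by rewrite mem_cat xl.
  by rewrite mem_cat xl orbT.
by move=> l _; have [t ?] := gram_schmidt l; exists t.
Qed.

Definition hsbounded T := exists C : R, forall s, onseq s -> hs_psum s T <= C.

Definition hs_norm2 T : R := sup [set hs_psum s T | s in [set s | onseq s]].

Lemma hs_norm2_ub T s : hsbounded T -> onseq s -> hs_psum s T <= hs_norm2 T.
Proof.
move=> [C hC] ons; apply: ub_le_sup; last by exists s.
by exists C => _ [t ont <-]; apply: hC.
Qed.

Lemma hs_norm2_le T C : (forall s, onseq s -> hs_psum s T <= C) -> hs_norm2 T <= C.
Proof.
move=> hC; apply: ge_sup; first by exists (hs_psum [::] T), [::].
by move=> _ [s ons <-]; apply: hC.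
Qed.

Lemma hs_norm2_ge0 T : hsbounded T -> 0 <= hs_norm2 T.
Proof.
by move=> bT; have := @hs_norm2_ub T [::] bT; rewrite {1}/hs_psum /hs_pdot big_nil; apply; split.
Qed.

Lemma hs_norm2_adherent T (e : R) : hsbounded T -> 0 < e ->
  exists2 s, onseq s & hs_norm2 T - e < hs_psum s T.
Proof.
move=> bT e0; have [|_ [s ons <-] h] := @sup_adherent R
  [set hs_psum s T | s in [set s | onseq s]] e e0.
  split; first by exists (hs_psum [::] T), [::].
  by case: bT => C hC; exists C => _ [t ont <-]; apply: hC.
by exists s.
Qed.

Lemma hs_norm2_cvg T : linear T -> hsbounded T -> hs_psum s T @[s --> onfilter] --> hs_norm2 T.
Proof.
move=> lT bT; apply/cvgrPdist_lt => e e0.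
have [s ons hs] := hs_norm2_adherent bT e0.
exists s => // t [ont st]; rewrite /= ger0_norm ?subr_ge0 ?hs_norm2_ub //.
by have := hs_psum_le lT ons st; lra.
Qed.

Lemma hnorm_le_nr T x : linear T -> hsbounded T -> hnorm (T x) ^+ 2 <= hs_norm2 T * hnorm x ^+ 2.
Proof.
move=> lT bT; have [->|x0] := eqVneq x 0.
  by rewrite linear_map0 // hnorm0 expr0n mulr0.
have xp := hnorm_gt0 x0.
have on1 : onseq [:: (hnorm x)^-1%:C *: x].
  by apply: onseq1; rewrite hnormZr ger0_norm ?invr_ge0 ?hnorm_ge0 // mulVf ?gt_eqF.
have := hs_norm2_ub bT on1.
rewrite hs_psumE big_seq1 linear_mapZ // hnormZr exprMn real_normK ?num_real //.
by rewrite exprVn ler_pdivrMl ?exprn_gt0 // mulrC.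
Qed.

End HSforms.

Section HSmore.
Variables (R : realType) (H : hilbertType R).
Implicit Types (s : seq H) (S T : H -> H).

Lemma hs_psumZ s a T : hs_psum s (a *: T) = normc a ^+ 2 * hs_psum s T.
Proof.
by rewrite !hs_psumE mulr_sumr; apply: eq_bigr => e _; rewrite hnormZ exprMn.
Qed.

Lemma hs_psumD_le s S T : hs_psum s (S + T) <= 2 * hs_psum s S + 2 * hs_psum s T.
Proof. by have := hs_psum_ge0 s (S - T); rewrite hs_psumB hs_psumD; lra. Qed.

Lemma hsboundedD S T : hsbounded S -> hsbounded T -> hsbounded (S + T).
Proof.
move=> [C hC] [D hD]; exists (2 * C + 2 * D) => s ons.
by rewrite (le_trans (hs_psumD_le _ _ _)) // lerD // ler_pM2l // ?hC ?hD.
Qed.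

Lemma hsboundedZ a T : hsbounded T -> hsbounded (a *: T).
Proof.
move=> [C hC]; exists (normc a ^+ 2 * C) => s ons.
by rewrite hs_psumZ ler_wpM2l ?sqr_ge0 // hC.
Qed.

Lemma hsbounded0 : hsbounded (0 : H -> H).
Proof.
exists 0 => s _; rewrite hs_psumE big1 // => e _.
by rewrite [X in hnorm X](_ : _ = 0) // hnorm0 expr0n.
Qed.

Lemma linear_fctD S T : linear S -> linear T -> linear (S + T).
Proof.
move=> lS lT a x y; rewrite -[LHS]/(S (a *: x + y) + T (a *: x + y)) lS lT.
by rewrite -[(S + T) x]/(S x + T x) -[(S + T) y]/(S y + T y) scalerDr addrACA.
Qed.

Lemma linear_fctZ b T : linear T -> linear (b *: T).
Proof.
move=> lT a x y; rewrite -[LHS]/(b *: T (a *: x + y)) lT.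
by rewrite -[(b *: T) x]/(b *: T x) -[(b *: T) y]/(b *: T y) scalerDr !scalerA mulrC.
Qed.

Lemma linear_fct0 : linear (0 : H -> H).
Proof. by move=> a x y; rewrite -[LHS]/(0 : H) scaler0 addr0. Qed.

Lemma cvg_hnorm_near (T : Type) (F : set_system T) {FF : Filter F} (f : T -> H) (x : H) (e : R) :
  f @ F --> x -> 0 < e -> \forall t \near F, hnorm (x - f t) < e.
Proof. by move=> /cvg_hnormP h e0; exact: (h e e0). Qed.

Lemma cvg_hnorm (T : Type) (F : set_system T) {FF : Filter F} (f : T -> H) (x : H) :
  f @ F --> x -> hnorm (f t) @[t --> F] --> hnorm x.
Proof.
move=> h; apply/cvgrPdist_lt => e e0.
apply: filterS (cvg_hnorm_near h e0) => t; apply: le_lt_trans.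
have := hnormD (x - f t) (f t); have := hnormD (f t - x) x; rewrite !subrK (hnormB (f t)).
by rewrite ler_norml => *; apply/andP; split; lra.
Qed.

Lemma cvg_sum_seq (T I : Type) (F : set_system T) {FF : Filter F} (s : seq I)
    (f : I -> T -> R) (a : I -> R) :
  (forall i, f i t @[t --> F] --> a i) ->
  \sum_(i <- s) f i t @[t --> F] --> \sum_(i <- s) a i.
Proof.
move=> h; elim: s => [|i s IH].
  by under eq_fun do rewrite big_nil; rewrite big_nil; exact: cvg_cst.
by under eq_fun do rewrite big_cons; rewrite big_cons; exact: cvgD.
Qed.

Lemma hilbert_hausdorff : hausdorff_space H.
Proof. exact: norm_hausdorff. Qed.

End HSmore.

Section HilbertSchmidt.
Variables (R : realType) (H : hilbertType R) (M : set H).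

Definition hs_pred : {pred H -> H} := fun T =>
  `[< [/\ linear T, forall c x, M c -> hdot (T x) c = 0 & hsbounded T] >].

Lemma hs_predP (T : H -> H) : reflect
  [/\ linear T, forall c x, M c -> hdot (T x) c = 0 & hsbounded T] (T \in hs_pred).
Proof. exact: asboolP. Qed.

Lemma hs_submod_closed : submod_closed hs_pred.
Proof.
split.
  apply/hs_predP; split; [exact: linear_fct0| |exact: hsbounded0].
  by move=> c x _; rewrite -[(0 : H -> H) x]/(0 : H) hdot0l.
move=> a S T /hs_predP[lS pS bS] /hs_predP[lT pT bT]; apply/hs_predP; split.
- by apply: linear_fctD => //; apply: linear_fctZ.
- move=> c x Mc; rewrite -[(a *: S + T) x]/(a *: S x + T x).
  by rewrite hdotDl hdotZl pS // pT // mulr0 addr0.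
- by apply: hsboundedD => //; apply: hsboundedZ.
Qed.

HB.instance Definition _ := GRing.isSubmodClosed.Build R[i] (H -> H) hs_pred hs_submod_closed.

Record hsop := HSop { hsval :> H -> H; hsvalP : hsval \in hs_pred }.

HB.instance Definition _ := [isSub for hsval].
HB.instance Definition _ := [Choice of hsop by <:].
HB.instance Definition _ := [SubChoice_isSubLmodule of hsop by <:].

Implicit Types S T : hsop.

Lemma hs_linear T : linear T. Proof. by case: T => T /= /hs_predP[]. Qed.
Lemma hs_perp T c x : M c -> hdot (T x) c = 0.
Proof. by case: T => T /= /hs_predP[_ h _]; apply: h. Qed.
Lemma hs_bounded T : hsbounded T. Proof. by case: T => T /= /hs_predP[]. Qed.

Lemma hsval_inj S T : (forall x, S x = T x) -> S = T.
Proof. by move=> h; apply: val_inj; apply/funext. Qed.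

Lemma hsvalB S T : hsval (S - T) = hsval S - hsval T. Proof. by []. Qed.

(** Polarization of a norm that is known to exist as a supremum. Bilinearity is not visible from
    this formula; it comes from [hs_pdot_cvg], where the value is a limit of bilinear partial
    sums. *)
Definition hs_rdot S T : R := (hs_norm2 (S + T) - hs_norm2 (S - T)) / 4.

Lemma hs_pdot_cvg S T : hs_pdot s S T @[s --> @onfilter R H] --> hs_rdot S T.
Proof.
under eq_fun do rewrite hs_pdot_polar.
apply: cvgMr_tmp; apply: cvgB; apply: hs_norm2_cvg.
- exact: (hs_linear (S + T)).
- exact: (hs_bounded (S + T)).
- exact: (hs_linear (S - T)).
- exact: (hs_bounded (S - T)).
Qed.

Lemma hs_pdot_lim S T (r : R) : hs_pdot s S T @[s --> @onfilter R H] --> r -> hs_rdot S T = r.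
Proof. by apply: (cvg_unique (@norm_hausdorff R R^o)); exact: hs_pdot_cvg. Qed.

Lemma hs_rdotC S T : hs_rdot S T = hs_rdot T S.
Proof.
by apply: hs_pdot_lim; under eq_fun do rewrite hs_pdotC; exact: hs_pdot_cvg.
Qed.

Lemma hs_rdotDl S S' T : hs_rdot (S + S') T = hs_rdot S T + hs_rdot S' T.
Proof.
by apply: hs_pdot_lim; under eq_fun do rewrite hs_pdotDl; apply: cvgD; exact: hs_pdot_cvg.
Qed.

Lemma hs_rdotZl (r : R) S T : hs_rdot (r%:C *: S) T = r * hs_rdot S T.
Proof.
by apply: hs_pdot_lim; under eq_fun do rewrite hs_pdotZl; apply: cvgMl_tmp; exact: hs_pdot_cvg.
Qed.

Lemma hs_rdotii S T : hs_rdot ('i *: S) ('i *: T) = hs_rdot S T.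
Proof.
by apply: hs_pdot_lim; under eq_fun do rewrite hs_pdotii; exact: hs_pdot_cvg.
Qed.

Lemma hs_rdotxx T : hs_rdot T T = hs_norm2 T.
Proof. by apply: hs_pdot_lim; apply: hs_norm2_cvg; [exact: hs_linear|exact: hs_bounded]. Qed.

Lemma hs_rdotDr S T T' : hs_rdot S (T + T') = hs_rdot S T + hs_rdot S T'.
Proof. by rewrite hs_rdotC hs_rdotDl !(hs_rdotC S). Qed.

Lemma hs_rdotZr (r : R) S T : hs_rdot S (r%:C *: T) = r * hs_rdot S T.
Proof. by rewrite hs_rdotC hs_rdotZl hs_rdotC. Qed.

Lemma hs_rdotNl S T : hs_rdot (- S) T = - hs_rdot S T.
Proof. by rewrite -scaleN1r -(mulN1r (hs_rdot _ _)) -hs_rdotZl rmorphN1. Qed.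

Lemma hs_rdot_iswap S T : hs_rdot S ('i *: T) = - hs_rdot ('i *: S) T.
Proof. by rewrite -[LHS]hs_rdotii scalerA -expr2 sqr_i scaleN1r hs_rdotC hs_rdotNl hs_rdotC. Qed.

Lemma hs_norm2_hs_ge0 T : 0 <= hs_norm2 T. Proof. exact/hs_norm2_ge0/hs_bounded. Qed.

Lemma hnorm_le_hs T x : hnorm (T x) ^+ 2 <= hs_norm2 T * hnorm x ^+ 2.
Proof. by apply: hnorm_le_nr; [exact: hs_linear|exact: hs_bounded]. Qed.

Lemma hs_norm2_hs_eq0 T : hs_norm2 T = 0 -> T = 0.
Proof.
move=> T0; apply: hsval_inj => x; apply: hnorm_eq0.
have := hnorm_le_hs T x; rewrite T0 mul0r => h.
by apply/eqP; rewrite -sqrf_eq0 eq_le h sqr_ge0.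
Qed.

Lemma hs_norm2_hsZ a T : hs_norm2 (a *: T) = normc a ^+ 2 * hs_norm2 T.
Proof.
rewrite -!hs_rdotxx; apply: hs_pdot_lim.
rewrite (_ : (fun s => _) = fun s => normc a ^+ 2 * hs_pdot s T T); last first.
  by apply/funext => s; exact: hs_psumZ.
by apply: cvgMl_tmp; exact: hs_pdot_cvg.
Qed.

Lemma hs_norm2_hsD S T : hs_norm2 (S + T) = hs_norm2 S + hs_norm2 T + 2 * hs_rdot S T.
Proof.
rewrite -(hs_rdotxx (S + T)) -(hs_rdotxx S) -(hs_rdotxx T).
rewrite (hs_rdotDl S T) (hs_rdotDr S) (hs_rdotDr T) (hs_rdotC T S).
by move: (hs_rdot S S) (hs_rdot T T) (hs_rdot S T) => a b c; ring.
Qed.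

Lemma hs_rdot_le S T : hs_rdot S T <= Num.sqrt (hs_norm2 S) * Num.sqrt (hs_norm2 T).
Proof.
have sS := sqr_sqrtr (hs_norm2_hs_ge0 S); have sT := sqr_sqrtr (hs_norm2_hs_ge0 T).
set p := Num.sqrt (hs_norm2 S) in sS *; set q := Num.sqrt (hs_norm2 T) in sT *.
have p0 : 0 <= p by exact: sqrtr_ge0. have q0 : 0 <= q by exact: sqrtr_ge0.
have [pE|pN] := eqVneq p 0.
  have -> : S = 0 by apply: hs_norm2_hs_eq0; rewrite -sS pE expr0n.
  by rewrite -(scale0r (0 : hsop)) (_ : 0 = 0%:C) // hs_rdotZl mul0r mulr_ge0.
have [qE|qN] := eqVneq q 0.
  have -> : T = 0 by apply: hs_norm2_hs_eq0; rewrite -sT qE expr0n.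
  by rewrite -(scale0r (0 : hsop)) (_ : 0 = 0%:C) // hs_rdotZr mul0r mulr_ge0.
have pp : 0 < p by rewrite lt_def pN. have qp : 0 < q by rewrite lt_def qN.
have := hs_norm2_hs_ge0 (q%:C *: S + (- p)%:C *: T).
rewrite hs_norm2_hsD !hs_norm2_hsZ hs_rdotZl hs_rdotZr !normc_sqr /= -sS -sT expr0n /= !addr0 => h.
have {h} : 0 <= (p * q) * (p * q - hs_rdot S T) by nra.
by rewrite pmulr_rge0 ?mulr_gt0 // subr_ge0.
Qed.

Definition hsnorm T : R[i] := (Num.sqrt (hs_norm2 T))%:C.

Lemma hsnormD S T : hsnorm (S + T) <= hsnorm S + hsnorm T.
Proof.
rewrite -rmorphD lecR -(@ler_pXn2r _ 2) ?nnegrE ?addr_ge0 ?sqrtr_ge0 //.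
rewrite sqr_sqrtr ?hs_norm2_hs_ge0 // hs_norm2_hsD sqrrD !sqr_sqrtr ?hs_norm2_hs_ge0 //.
by have := hs_rdot_le S T; rewrite -mulr_natr; lra.
Qed.

Lemma hsnormZ a T : hsnorm (a *: T) = `|a| * hsnorm T.
Proof.
rewrite /hsnorm hs_norm2_hsZ sqrtrM ?sqr_ge0 // sqrtr_sqr ger0_norm ?normc_ge0 //.
by rewrite rmorphM.
Qed.

Lemma hsnorm_eq0 T : hsnorm T = 0 -> T = 0.
Proof.
move=> /complexI /eqP; rewrite sqrtr_eq0 => h; apply: hs_norm2_hs_eq0.
by apply/eqP; rewrite eq_le h hs_norm2_hs_ge0.
Qed.

HB.instance Definition _ := @Lmodule_isNormed.Build R[i] hsop hsnorm hsnormD hsnormZ hsnorm_eq0.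

Lemma hsnormE T : `|T| = (Num.sqrt (hs_norm2 T))%:C. Proof. by []. Qed.

(** The limit operator [L] is taken vector by vector. Each [hs_psum s] involves finitely many
    vectors and so passes to the limit, with a bound uniform in [s]; this yields both that [L] is
    Hilbert-Schmidt and that convergence holds in norm. *)
Lemma hs_cauchy_cvg (F : set_system hsop) : ProperFilter F -> cauchy F -> cvg F.
Proof.
move=> FF /cauchy_ballP Fc.
have small (e : R) : 0 < e ->
    exists2 A, F A & forall S T, A S -> A T -> hs_norm2 (S - T) <= e.
  move=> e0; have [|[P Q] [/= FP FQ] hPQ] := Fc (Num.sqrt e)%:C.
    by rewrite ltcR sqrtr_gt0.
  exists (P `&` Q); first exact: filterI.
  move=> S T [PS _] [_ QT]; have := hPQ (S, T) (conj PS QT).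
  by rewrite -ball_normE /= hsnormE ltcR => h; apply/ltW; rewrite -(ltr_sqrt _ e0).
have lim x : exists y : H, (fun T : hsop => T x) @ F --> y.
  have PF : ProperFilter (fmap (fun T : hsop => T x) F) by exact: fmap_proper_filter.
  apply: (@hilbert_cauchy R H _ PF) => e e0.
  have e1 : 0 < e ^+ 2 / (2 * (hnorm x ^+ 2 + 1)).
    by rewrite divr_gt0 ?exprn_gt0 // mulr_gt0 // ltr_wpDl ?sqr_ge0.
  have [A FA hA] := small _ e1.
  exists ((fun T : hsop => T x) @` A); first by apply: (@filterS _ F _ A) => // T AT; exists T.
  move=> _ _ [S AS <-] [T AT <-]; rewrite -(@ltr_pXn2r _ 2) ?nnegrE ?hnorm_ge0 ?ltW //.
  have := hnorm_le_hs (S - T) x; move/le_lt_trans; apply.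
  apply: (@le_lt_trans _ _ (e ^+ 2 / (2 * (hnorm x ^+ 2 + 1)) * hnorm x ^+ 2)).
    by rewrite ler_wpM2r ?sqr_ge0 // hA.
  have n0 := sqr_ge0 (hnorm x); have e2 : 0 < e ^+ 2 by rewrite exprn_gt0.
  rewrite mulrAC ltr_pdivrMr; last by rewrite mulr_gt0 // ltr_wpDl.
  by nra.
have [L hL] := choice lim.
have lL : linear L.
  move=> a x y; apply: (cvg_unique (@hilbert_hausdorff _ H) (hL _)).
  rewrite (_ : (fun T : hsop => T (a *: x + y)) = fun T => a *: T x + T y); last first.
    by apply/funext => T; rewrite hs_linear.
  by apply: cvgD; [apply: cvgZl_tmp|]; exact: hL.
have pL c x : M c -> hdot (L x) c = 0.
  move=> Mc; apply: ComplexField.Normc.eq0_normc; apply/eqP; rewrite eq_le normc_ge0 andbT.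
  apply/ler_addgt0Pr => e e0; rewrite add0r.
  have e1 : 0 < e / (hnorm c + 1) by rewrite divr_gt0 // ltr_wpDl ?hnorm_ge0.
  have hx : \forall T \near F, hnorm (L x - (T : hsop) x) < e / (hnorm c + 1).
    by apply: cvg_hnorm_near e1; exact: hL.
  have [T hT] := filter_ex hx.
  have -> : hdot (L x) c = hdot (L x - T x) c by rewrite hdotBl (hs_perp T) // subr0.
  rewrite (le_trans (cauchy_schwarz _ _)) //.
  have := hnorm_ge0 c; rewrite ltr_pdivlMr ?ltr_wpDl ?hnorm_ge0 // in hT *.
  have := hnorm_ge0 (L x - T x); nra.
have close (e : R) (A : set hsop) : F A ->
    (forall S T, A S -> A T -> hs_norm2 (S - T) <= e) ->
    forall T s, A T -> onseq s -> hs_psum s (hsval T - L) <= e.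
  move=> FA hA T s AT ons.
  have hc : hs_psum s (hsval T - hsval S) @[S --> F] --> hs_psum s (hsval T - L).
    under eq_fun do rewrite hs_psumE.
    rewrite hs_psumE; apply: cvg_sum_seq => e'.
    rewrite expr2; under eq_fun do rewrite expr2.
    have h1 : hnorm (T e' - (S : hsop) e') @[S --> F] --> hnorm (T e' - L e').
      by apply: cvg_hnorm; apply: cvgB; [exact: cvg_cst|exact: hL].
    by apply: cvgM; exact: h1.
  apply: (cvgr_to_le hc).
  apply: filterS FA => S AS; apply: le_trans (hA _ _ AT AS).
  by apply: (hs_norm2_ub (hs_bounded (T - S))).
have bL : hsbounded L.
  have [A FA hA] := small 1 ltr01; have [T AT] := filter_ex FA.
  exists (2 * hs_norm2 T + 2) => s ons.
  have -> : L = hsval T + (-1) *: (hsval T - L).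
    by rewrite scaleN1r opprB addrC subrK.
  rewrite (le_trans (hs_psumD_le _ _ _)) // lerD //.
    by rewrite ler_pM2l // hs_norm2_ub //; exact: hs_bounded.
  rewrite hs_psumZ normc_sqr /= oppr0 expr0n addr0 sqrrN expr1n mul1r.
  by have := close _ _ FA hA T s AT ons; lra.
have LP : L \in hs_pred by apply/hs_predP; split.
apply/cvg_ex; exists (HSop LP); apply/cvgrPdist_lt => e e0.
have e_real : e = (Re e)%:C by rewrite RRe_real // gtr0_real.
have e1 : 0 < Re e by rewrite -ltcR -e_real.
have e2 : 0 < Re e ^+ 2 / 2 by rewrite divr_gt0 ?exprn_gt0.
have [A FA hA] := small _ e2; have FA' := FA; apply: filterS FA' => T AT.
rewrite distrC hsnormE e_real ltcR -(@ltr_pXn2r _ 2) ?nnegrE ?sqrtr_ge0 ?(ltW e1) //.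
rewrite sqr_sqrtr ?hs_norm2_hs_ge0 //; apply: (@le_lt_trans _ _ (Re e ^+ 2 / 2)).
  by apply: hs_norm2_le => s ons; exact: (close _ _ FA hA).
by have := exprn_gt0 2 e1; lra.
Qed.

HB.instance Definition _ := Uniform_isComplete.Build hsop hs_cauchy_cvg.

(** A complex inner product is determined by its real part; this is the formula of [hdotE]. *)
Definition hshdot S T : R[i] := hs_rdot S T +i* - hs_rdot ('i *: S) T.

Lemma hshdotDl S S' T : hshdot (S + S') T = hshdot S T + hshdot S' T.
Proof.
rewrite /hshdot scalerDr !hs_rdotDl.
move: (hs_rdot S T) (hs_rdot S' T) (hs_rdot ('i *: S) T) (hs_rdot ('i *: S') T) => b b' c c'.
by apply/eqP; rewrite eq_complex /=; apply/andP; split; apply/eqP; ring.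
Qed.

Lemma hshdotZl a S T : hshdot (a *: S) T = a * hshdot S T.
Proof.
case: a => p q; rewrite /hshdot.
have E : (p +i* q) *: S = p%:C *: S + q%:C *: ('i *: S).
  rewrite scalerA -scalerDl; congr (_ *: _).
  by apply/eqP; rewrite eq_complex /=; apply/andP; split; apply/eqP; ring.
have E' : 'i *: ((p +i* q) *: S) = p%:C *: ('i *: S) + (- q)%:C *: S.
  rewrite !scalerA -scalerDl; congr (_ *: _).
  by apply/eqP; rewrite eq_complex /=; apply/andP; split; apply/eqP; ring.
rewrite E' E !hs_rdotDl !hs_rdotZl; move: (hs_rdot S T) (hs_rdot ('i *: S) T) => b c.
by apply/eqP; rewrite eq_complex /=; apply/andP; split; apply/eqP; ring.
Qed.

Lemma hshdotC S T : hshdot S T = conjc (hshdot T S).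
Proof.
rewrite /hshdot (hs_rdotC T S) (hs_rdotC _ S) hs_rdot_iswap.
by apply/eqP; rewrite eq_complex /= !opprK !eqxx.
Qed.

Lemma hshdotxx T : hshdot T T = (hs_norm2 T)%:C.
Proof.
rewrite /hshdot hs_rdotxx; congr (_ +i* _).
by have := hs_rdot_iswap T T; rewrite hs_rdotC; move: (hs_rdot _ _) => b; lra.
Qed.

Lemma hshdot_bilinear : bilinear_for *%R (@conjc R \; *%R) hshdot.
Proof.
split=> T a x y /=; first by rewrite hshdotDl hshdotZl.
rewrite hshdotC hshdotDl hshdotZl (hshdotC T x) (hshdotC T y).
by rewrite (rmorphD (@conjc R)) (rmorphM (@conjc R)).
Qed.

HB.instance Definition _ := bilinear_isBilinear.Build R[i] hsop hsop R[i]
  *%R (@conjc R \; *%R) hshdot hshdot_bilinear.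

Lemma hshdot_herm S T : hshdot S T = (-1) ^+ false * conjc (hshdot T S).
Proof. by rewrite expr0 mul1r -hshdotC. Qed.

HB.instance Definition _ := isHermitianSesquilinear.Build R[i] hsop false
  (@conjc R) hshdot hshdot_herm.

Lemma hshdot_gt0 T : T != 0 -> 0 < hshdot T T.
Proof.
move=> T0; rewrite hshdotxx ltcR lt_def hs_norm2_hs_ge0 andbT.
by apply: contra T0 => /eqP /hs_norm2_hs_eq0 ->.
Qed.

HB.instance Definition _ := isDotProduct.Build R[i] hsop hshdot hshdot_gt0.

Lemma hshdot_norm T : `|T| ^+ 2 = hshdot T T.
Proof. by rewrite hsnormE -rmorphXn sqr_sqrtr ?hs_norm2_hs_ge0 // hshdotxx. Qed.

HB.instance Definition _ := @isHilbert.Build R hsop hshdot hshdot_norm.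

Definition hsHilbert : hilbertType R := hsop.

Lemma hnorm_hs T : hnorm (T : hsHilbert) = Num.sqrt (hs_norm2 T).
Proof. by []. Qed.

End HilbertSchmidt.

(** * Compact vectors and the conjugation representation *)

Section ProductConvergence.
Variables (I : Type) (T : I -> topologicalType).

Lemma prod_cvgP (F : set_system (prod_topology T)) (f : prod_topology T) :
  Filter F -> F --> f <-> forall i, (fun g : prod_topology T => g i) @ F --> f i.
Proof.
move=> FF; split.
  move=> /cvg_sup h i.
  apply: cvg_trans (@initial_continuous _ _ (fun g : prod_topology T => g i) f).
  exact: cvg_app (h i).
move=> h; apply/cvg_sup => i A /=.
rewrite (@nbhsE (initial_topology (fun g : prod_topology T => g i))) /=.
move=> -[B [[V oV <-] /= Vf] BA].
by apply: (@filterS _ F _ _ _ BA); apply: h; exact: open_nbhs_nbhs.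
Qed.

Lemma eval_continuous i : continuous (fun g : prod_topology T => g i).
Proof. by move=> f; have /prod_cvgP := @cvg_id _ (nbhs f); apply. Qed.

Lemma continuous_prod (X : topologicalType) (h : X -> prod_topology T) :
  continuous h <-> forall i, continuous (fun x => h x i).
Proof.
split=> [hc i x|hc x]; first exact: (cvg_comp _ _ (hc x) (@eval_continuous i (h x))).
by apply/prod_cvgP => i; exact: hc.
Qed.

End ProductConvergence.

(** * Totally bounded subsets of a Hilbert space *)

Section TotallyBounded.
Variables (R : realType) (H : hilbertType R).
Implicit Types (A B : set H) (v w : H).

Definition tbounded A := forall e : R, 0 < e ->
  exists l : seq H, forall a, A a -> exists2 y, y \in l & hnorm (a - y) < e.

Lemma tbounded_sub A B : A `<=` B -> tbounded B -> tbounded A.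
Proof. by move=> AB tB e e0; have [l hl] := tB e e0; exists l => a /AB /hl. Qed.

Lemma tbounded_add A B : tbounded A -> tbounded B ->
  tbounded [set x | exists2 a, A a & exists2 b, B b & x = a + b].
Proof.
move=> tA tB e e0; have e2 : 0 < e / 2 by rewrite divr_gt0.
have [l hl] := tA _ e2; have [l' hl'] := tB _ e2.
exists [seq x + y | x <- l, y <- l'] => _ [a Aa [b Bb ->]].
have [x xl ax] := hl _ Aa; have [y yl by_] := hl' _ Bb.
exists (x + y); first exact: allpairs_f.
rewrite opprD addrACA (le_lt_trans (hnormD _ _)) //.
by have := ltrD ax by_; rewrite -splitr.
Qed.

Lemma tbounded_scale (c : R[i]) A : tbounded A -> tbounded [set x | exists2 a, A a & x = c *: a].
Proof.
move=> tA e e0; have c1 : 0 < normc c + 1 by rewrite ltr_wpDl ?normc_ge0.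
have [l hl] := tA _ (divr_gt0 e0 c1).
exists [seq c *: y | y <- l] => _ [a Aa ->]; have [y yl ay] := hl _ Aa.
exists (c *: y); first exact: map_f.
rewrite -scalerBr hnormZ; rewrite ltr_pdivlMr // in ay.
by have := hnorm_ge0 (a - y); have := normc_ge0 c; nra.
Qed.

Lemma tbounded_approx A :
  (forall e : R, 0 < e -> exists2 B, tbounded B &
     forall a, A a -> exists2 b, B b & hnorm (a - b) < e) -> tbounded A.
Proof.
move=> h e e0; have e2 : 0 < e / 2 by rewrite divr_gt0.
have [B tB AB] := h _ e2; have [l hl] := tB _ e2.
exists l => a /AB[b /hl [y yl byl] ab]; exists y => //.
rewrite (le_lt_trans (hnormDB _ b _)) //.
by have := ltrD ab byl; rewrite -splitr.
Qed.

Lemma tbounded_segment v (r : R) : tbounded [set x | exists2 t : R, `|t| <= r & x = t%:C *: v].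
Proof.
move=> e e0; have v1 : 0 < hnorm v + 1 by rewrite ltr_wpDl ?hnorm_ge0.
pose d := e / (hnorm v + 1); have d0 : 0 < d by rewrite divr_gt0.
exists [seq (k%:R * d - r)%:C *: v | k <- iota 0 (Num.truncn (2 * r / d)).+1].
move=> x [t]; rewrite ler_norml => /andP[rt tr] ->.
have u0 : 0 <= (t + r) / d by rewrite divr_ge0 ?(ltW d0) //; lra.
have /andP[k1 k2] := truncn_itv u0; set k := Num.truncn _ in k1 k2.
exists ((k%:R * d - r)%:C *: v).
  apply/mapP; exists k => //; rewrite mem_iota add0n ltnS.
  by apply: le_truncn; rewrite ler_pM2r ?invr_gt0 //; lra.
rewrite -scalerBl -rmorphB hnormZr.
move: k1 k2; rewrite ler_pdivlMr // ltr_pdivrMr // -natr1 mulrDl mul1r => k1 k2.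
have h : `|t - (k%:R * d - r)| <= d by rewrite ler_norml; apply/andP; split; lra.
rewrite (le_lt_trans (ler_wpM2r (hnorm_ge0 v) h)) // /d mulrAC ltr_pdivrMr //.
by have := hnorm_ge0 v; nra.
Qed.

Lemma tbounded_disc v (r : R) : tbounded [set x | exists2 c, normc c <= r & x = c *: v].
Proof.
apply: tbounded_sub (tbounded_add (tbounded_segment v r) (tbounded_segment ('i *: v) r)).
move=> _ [c cr ->].
have cc := normc_sqr c.
have rr : normc c ^+ 2 <= r ^+ 2.
  by rewrite ler_pXn2r // nnegrE ?normc_ge0 // (le_trans (normc_ge0 c)).
have r0 : 0 <= r by rewrite (le_trans (normc_ge0 c)).
have sq (x : R) : x ^+ 2 <= r ^+ 2 -> `|x| <= r.
  by move=> h; rewrite -(@ler_pXn2r _ 2) ?nnegrE // real_normK ?num_real.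
exists ((Re c)%:C *: v).
  by exists (Re c) => //; apply: sq; have := sqr_ge0 (Im c); lra.
exists ((Im c)%:C *: ('i *: v)).
  by exists (Im c) => //; apply: sq; have := sqr_ge0 (Re c); lra.
rewrite scalerA -scalerDl {1}[c]complexE; congr ((_ + _) *: _).
by rewrite mulrC.
Qed.

(** A finite rank operator maps a ball into such a set, which is how compactness of Hilbert-Schmidt
    operators is expressed. *)
Lemma tbounded_comb (s : seq H) (T : H -> H) (r : R) :
  tbounded [set x | exists2 a : H -> R[i], (forall e, e \in s -> normc (a e) <= r) &
      x = \sum_(e <- s) a e *: T e].
Proof.
elim: s => [|e s IH].
  move=> d d0; exists [:: 0] => _ [a _ ->]; exists 0; rewrite ?inE //.
  by rewrite big_nil subrr hnorm0.
apply: tbounded_sub (tbounded_add (tbounded_disc (T e) r) IH) => _ [a ha ->].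
exists (a e *: T e); first by exists (a e) => //; apply: ha; rewrite mem_head.
exists (\sum_(f <- s) a f *: T f); last by rewrite big_cons.
by exists a => // f fs; apply: ha; rewrite inE fs orbT.
Qed.

End TotallyBounded.

Section Representation.
Variables (R : realType) (G : topologicalGroupType) (H : hilbertType R).
Variable pi : unitaryRep G H.
Implicit Types (g h : G) (v w : H).

Lemma rep_linear g : linear (pi g : H -> H).
Proof. by have [] := rep_unitary pi g. Qed.

Lemma rep_hdot g v w : hdot (pi g v) (pi g w) = hdot v w.
Proof. by have [] := rep_unitary pi g. Qed.

Lemma rep_hnorm g v : hnorm (pi g v) = hnorm v.
Proof.
by apply/eqP; rewrite -(@eqrXn2 _ 2) ?hnorm_ge0 // -!rdotxx /rdot rep_hdot.
Qed.

Lemma rep1 v : pi 1%g v = v.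
Proof.
have [_ _ /bij_inj inj] := rep_unitary pi 1%g.
by apply: inj; rewrite -repM mulg1.
Qed.

Lemma repK g v : pi g^-1%g (pi g v) = v.
Proof. by rewrite -repM mulVg rep1. Qed.

Lemma repVK g v : pi g (pi g^-1%g v) = v.
Proof. by rewrite -repM mulgV rep1. Qed.

Lemma rep_hdotV g v w : hdot (pi g v) w = hdot v (pi g^-1%g w).
Proof. by rewrite -(rep_hdot g v) repVK. Qed.

Lemma rep_hnormB g v w : hnorm (pi g v - pi g w) = hnorm (v - w).
Proof. by rewrite -linear_mapB ?rep_hnorm //; exact: rep_linear. Qed.

Lemma rep_orbit_continuous v : continuous (fun g => pi g v : H).
Proof. exact: (iffLR (continuous_prod _) (@rep_continuous _ _ _ pi) v). Qed.

Lemma rep_near g v (e : R) : 0 < e -> \forall h \near g, hnorm (pi g v - pi h v) < e.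
Proof. by move=> e0; apply: cvg_hnorm_near e0; exact: rep_orbit_continuous. Qed.

Definition compact_vectors : set H := [set v | tbounded (range (fun g => pi g v))].

Lemma compact_vectors_rep g v : compact_vectors v -> compact_vectors (pi g v).
Proof.
by apply: tbounded_sub => _ [h _ <-]; exists (h * g)%g; rewrite ?repM.
Qed.

Lemma compact_vectorsD v w :
  compact_vectors v -> compact_vectors w -> compact_vectors (v + w).
Proof.
move=> tv tw; apply: tbounded_sub (tbounded_add tv tw) => _ [g _ <-].
exists (pi g v); first by exists g.
by exists (pi g w); [exists g|rewrite linear_mapD //; exact: rep_linear].
Qed.

Lemma compact_vectorsZ c v : compact_vectors v -> compact_vectors (c *: v).
Proof.
move=> /(tbounded_scale c); apply: tbounded_sub => _ [g _ <-].
by exists (pi g v); [exists g|rewrite linear_mapZ //; exact: rep_linear].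
Qed.

Lemma compact_vectors0 : compact_vectors 0.
Proof.
move=> e e0; exists [:: 0] => _ [g _ <-]; exists 0; rewrite ?inE //.
by rewrite linear_map0 ?subrr ?hnorm0 //; exact: rep_linear.
Qed.

(** Unitarity makes an approximation of [v] uniform along the orbit. With the three preceding
    lemmas, the compact vectors form a closed subspace. *)
Lemma compact_vectors_closed v :
  (forall e : R, 0 < e -> exists2 w, compact_vectors w & hnorm (v - w) < e) ->
  compact_vectors v.
Proof.
move=> h; apply: tbounded_approx => e e0; have [w tw vw] := h e e0.
exists (range (fun g => pi g w)) => // _ [g _ <-].
by exists (pi g w); [exists g|rewrite rep_hnormB].
Qed.

End Representation.

Section Conjugation.
Variables (R : realType) (G : topologicalGroupType) (H : hilbertType R).
Variables (pi : unitaryRep G H) (M : set H).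
Hypothesis piM : forall g v, M v -> M (pi g v).
Implicit Types (g h : G) (v w x : H) (S T : hsop M).

Lemma onseq_rep g (s : seq H) : onseq s -> onseq [seq pi g e | e <- s].
Proof.
move=> [us ons]; have inj : injective (pi g : H -> H) by apply: can_inj (repK pi g).
split; first by rewrite map_inj_uniq.
by move=> _ _ /mapP[e es ->] /mapP[f fs ->]; rewrite rep_hdot ons // inj_eq.
Qed.

Definition conj_fun g (T : H -> H) : H -> H := fun x => pi g (T (pi g^-1%g x)).

Lemma hs_psum_conj g (s : seq H) (T : H -> H) :
  hs_psum s (conj_fun g T) = hs_psum [seq pi g^-1%g e | e <- s] T.
Proof. by rewrite !hs_psumE big_map; apply: eq_bigr => e _; rewrite rep_hnorm. Qed.

Lemma conj_hs g T : conj_fun g T \in hs_pred M.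
Proof.
apply/hs_predP; split.
- by move=> a x y; rewrite /conj_fun rep_linear hs_linear rep_linear.
- by move=> c x Mc; rewrite /conj_fun rep_hdotV hs_perp //; exact: piM.
- have [C hC] := hs_bounded T; exists C => s ons.
  by rewrite hs_psum_conj hC //; exact: onseq_rep.
Qed.

Definition hsact g T : hsHilbert M := HSop (conj_hs g T).

Lemma hs_norm2_conj_le g T : hs_norm2 (conj_fun g T) <= hs_norm2 T.
Proof.
apply: hs_norm2_le => s ons; rewrite hs_psum_conj hs_norm2_ub //; first exact: hs_bounded.
exact: onseq_rep.
Qed.

Lemma hsactM g h T : hsact (g * h)%g T = hsact g (hsact h T).
Proof. by apply: hsval_inj => x /=; rewrite /conj_fun /= repM invgM repM. Qed.

Lemma hsact1 T : hsact 1%g T = T.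
Proof. by apply: hsval_inj => x /=; rewrite /conj_fun /= invg1 !rep1. Qed.

Lemma hsactK g T : hsact g^-1%g (hsact g T) = T.
Proof. by rewrite -hsactM mulVg hsact1. Qed.

Lemma hs_norm2_hsact g T : hs_norm2 (hsact g T : hsop M) = hs_norm2 T.
Proof.
apply/eqP; rewrite eq_le hs_norm2_conj_le /=.
by rewrite -{1}(hsactK g T) hs_norm2_conj_le.
Qed.

Lemma hsact_linear g : linear (hsact g).
Proof.
move=> a S T; apply: hsval_inj => x /=.
by rewrite /conj_fun /= -[LHS]/(pi g (a *: S _ + T _)) rep_linear.
Qed.

Lemma hsactD g S T : hsact g (S + T) = hsact g S + hsact g T.
Proof. by have := hsact_linear g 1 S T; rewrite !scale1r. Qed.

Lemma hsactZ g a T : hsact g (a *: T) = a *: hsact g T.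
Proof. by apply: hsval_inj => x /=; rewrite /conj_fun linear_mapZ //; exact: rep_linear. Qed.

Lemma hsactB g S T : hsact g (S - T) = hsact g S - hsact g T.
Proof. by rewrite -scaleN1r hsactD hsactZ scaleN1r. Qed.

Lemma hs_rdot_hsact g S T : hs_rdot (hsact g S : hsop M) (hsact g T) = hs_rdot S T.
Proof.
by rewrite /hs_rdot -hsactD -hsactB; congr ((_ - _) / _); exact: hs_norm2_hsact.
Qed.

Lemma hdot_hsact g S T : hdot (hsact g S) (hsact g T) = hdot (S : hsHilbert M) T.
Proof.
rewrite -[LHS]/(hshdot _ _) -[RHS]/(hshdot _ _) /hshdot.
by rewrite -hsactZ !hs_rdot_hsact.
Qed.

Lemma hsact_unitary g : unitary (hsact g : hsHilbert M -> hsHilbert M).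
Proof.
split; [exact: hsact_linear|exact: hdot_hsact|].
exists (hsact g^-1%g); first exact: hsactK.
by move=> T; rewrite -{1}(invgK g) hsactK.
Qed.

Lemma hnorm_hsact g T : hnorm (hsact g T) = hnorm (T : hsHilbert M).
Proof. by rewrite !hnorm_hs hs_norm2_hsact. Qed.

Lemma hnorm_hs_le T (r : R) : 0 <= r -> hs_norm2 T <= r ^+ 2 -> hnorm (T : hsHilbert M) <= r.
Proof.
move=> r0 h; rewrite hnorm_hs -(@ler_pXn2r _ 2) ?nnegrE ?sqrtr_ge0 //.
by rewrite sqr_sqrtr ?hs_norm2_hs_ge0.
Qed.

Lemma hnorm_hs_apply T x : hnorm (T x) <= hnorm (T : hsHilbert M) * hnorm x.
Proof.
rewrite -(@ler_pXn2r _ 2) ?nnegrE ?mulr_ge0 ?hnorm_ge0 // exprMn hnorm_hs.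
by rewrite sqr_sqrtr ?hs_norm2_hs_ge0 // hnorm_le_hs.
Qed.

Definition perp : set H := [set a | forall c, M c -> hdot a c = 0].

Lemma perp_rep g a : perp a -> perp (pi g a).
Proof. by move=> pa c Mc; rewrite rep_hdotV pa //; exact: piM. Qed.

Lemma perpB a b : perp a -> perp b -> perp (a - b).
Proof. by move=> pa pb c Mc; rewrite hdotBl pa // pb // subrr. Qed.

Definition rank1_fun (a b : H) : H -> H := fun x => hdot x b *: a.

Lemma hs_psum_rank1 a b (s : seq H) : onseq s ->
  hs_psum s (rank1_fun a b) <= (hnorm a * hnorm b) ^+ 2.
Proof.
move=> ons; rewrite hs_psumE; under eq_bigr do rewrite hnormZ exprMn mulrC.
rewrite -mulr_sumr exprMn ler_wpM2l ?sqr_ge0 // (le_trans _ (bessel b ons)) //.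
by rewrite le_eqVlt; apply/orP; left; apply/eqP; apply: eq_bigr => e _; rewrite hdotC normcJ.
Qed.

Lemma rank1_hs a b : perp a -> rank1_fun a b \in hs_pred M.
Proof.
move=> pa; apply/hs_predP; split.
- by move=> c x y; rewrite /rank1_fun hdotDl hdotZl scalerDl scalerA.
- by move=> c x Mc; rewrite /rank1_fun hdotZl pa // mulr0.
- by exists ((hnorm a * hnorm b) ^+ 2) => s; exact: hs_psum_rank1.
Qed.

Definition rank1 a b (pa : perp a) : hsHilbert M := HSop (rank1_hs b pa).

Lemma hnorm_rank1 a b (pa : perp a) : hnorm (rank1 b pa) <= hnorm a * hnorm b.
Proof.
apply: hnorm_hs_le; first by rewrite mulr_ge0 ?hnorm_ge0.
by apply: hs_norm2_le => s; exact: hs_psum_rank1.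
Qed.

(** This is [T \o proj s], written with rank one operators because continuity of orbits is checked
    by hand only for those. The summands belong to the space since each [T e] is orthogonal to
    [M]. *)
Definition finrank (s : seq H) T : hsHilbert M :=
  \sum_(e <- s) rank1 e (fun c => hs_perp T e (c := c)).

Lemma hs_sumE I (s : seq I) (F : I -> hsop M) x :
  (\sum_(i <- s) F i : hsop M) x = \sum_(i <- s) F i x.
Proof. by elim: s => [|i s IH]; rewrite ?big_nil ?big_cons //= -IH. Qed.

Lemma finrankE s T x : (finrank s T : hsop M) x = T (proj s x).
Proof.
by rewrite /finrank hs_sumE /proj linear_map_sum //; exact: hs_linear.
Qed.

Lemma hs_approx T (e : R) : 0 < e ->
  exists2 s, onseq s & hnorm ((T : hsHilbert M) - finrank s T) < e.
Proof.
move=> e0; have e2 : 0 < (e / 2) ^+ 2 by rewrite exprn_gt0 ?divr_gt0.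
have lT := hs_linear T; have bT := hs_bounded T.
have [s ons hs] := hs_norm2_adherent bT e2; exists s => //.
apply: (@le_lt_trans _ _ (e / 2)); last by lra.
apply: hnorm_hs_le; first by rewrite ltW ?divr_gt0.
(* The span of [u] contains [t] and [s]. Passing from [t] to [u] can only increase the sum, and over
   [u] it equals [hs_psum u T - hs_psum s T], small by the choice of [s]. *)
apply: hs_norm2_le => t ont; have [u [onu hu]] := gram_schmidt (t ++ s).
have hut f : f \in t -> proj u f = f by move=> ft; apply: hu; rewrite mem_cat ft.
have hus f : f \in s -> proj u f = f by move=> fs; apply: hu; rewrite mem_cat fs orbT.
rewrite (le_trans (hs_psum_le (hs_linear (T - finrank s T)) ont hut)) //.
have -> : hsval (T - finrank s T) = hsval T - (hsval T \o proj s).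
  by apply/funext => x; rewrite hsvalB -[LHS]/(T x - (finrank s T : hsop M) x) finrankE.
by rewrite hs_psum_sub_proj //; have := hs_norm2_ub bT onu; lra.
Qed.

End Conjugation.

Section ConjugationRep.
Variables (R : realType) (G : topologicalGroupType) (H : hilbertType R).
Variables (pi : unitaryRep G H) (M : set H).
Hypothesis piM : forall g v, M v -> M (pi g v).
Implicit Types (g h : G) (v w x : H) (S T : hsHilbert M).

Local Notation act := (hsact piM).

Let orbit_continuous T := forall g (e : R), 0 < e ->
  \forall h \near g, hnorm (act g T - act h T) < e.

Let orbit_continuousD S T :
  orbit_continuous S -> orbit_continuous T -> orbit_continuous (S + T).
Proof.
move=> cS cT g e e0; have e2 : 0 < e / 2 by rewrite divr_gt0.
apply: filterS2 (cS g _ e2) (cT g _ e2) => h hS hT.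
rewrite !hsactD opprD addrACA (le_lt_trans (hnormD _ _)) //.
by have := ltrD hS hT; rewrite -splitr.
Qed.

Let orbit_continuous_sum I (s : seq I) (F : I -> hsHilbert M) :
  (forall i, orbit_continuous (F i)) -> orbit_continuous (\sum_(i <- s) F i).
Proof.
move=> hF; elim: s => [|i s IH]; last by rewrite big_cons; exact: orbit_continuousD.
rewrite big_nil => g e e0; near=> h.
rewrite -(scale0r (0 : hsHilbert M)) !(hsactZ piM) !scale0r subrr.
by rewrite (hnorm0 (hsHilbert M)).
Unshelve. all: by end_near. Qed.

Let rank1B a a' b b' (pa : perp M a) (pa' : perp M a') :
  rank1 b pa - rank1 b' pa' = rank1 b (perpB pa pa') + rank1 (b - b') pa'.
Proof.
apply: hsval_inj => x.
rewrite -[LHS]/(hdot x b *: a - hdot x b' *: a').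
rewrite -[RHS]/(hdot x b *: (a - a') + hdot x (b - b') *: a').
have -> : hdot x (b - b') = hdot x b - hdot x b'.
  by rewrite hdotC hdotBl (rmorphB (@conjc R)) (hdotC x b) (hdotC x b').
by rewrite scalerBr scalerBl addrA subrK.
Qed.

Let hsact_rank1 g a b (pa : perp M a) :
  act g (rank1 b pa) = rank1 (pi g b) (perp_rep piM g pa).
Proof.
apply: hsval_inj => x.
rewrite -[LHS]/(pi g (hdot (pi g^-1%g x) b *: a)) -[RHS]/(hdot x (pi g b) *: pi g a).
rewrite linear_mapZ; last exact: rep_linear.
by rewrite rep_hdotV invgK.
Qed.

Let orbit_continuous_rank1 a b (pa : perp M a) : orbit_continuous (rank1 b pa).
Proof.
move=> g e e0.
have k0 : 0 < 2 * (hnorm a + hnorm b + 1) by have := hnorm_ge0 a; have := hnorm_ge0 b; lra.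
have e1 : 0 < e / (2 * (hnorm a + hnorm b + 1)) by rewrite divr_gt0.
apply: filterS2 (rep_near pi g a e1) (rep_near pi g b e1) => h ha hb.
rewrite !hsact_rank1 rank1B (le_lt_trans (hnormD _ _)) //.
have := lerD (hnorm_rank1 (pi g b) (perpB (perp_rep piM g pa) (perp_rep piM h pa)))
  (hnorm_rank1 (pi g b - pi h b) (perp_rep piM h pa)).
move/le_lt_trans; apply; rewrite !rep_hnorm; move: ha hb; rewrite !ltr_pdivlMr //.
move: (hnorm (_ - _)) (hnorm (_ - _)) (hnorm_ge0 (pi g a - pi h a)) (hnorm_ge0 (pi g b - pi h b)).
by move=> p q p0 q0; have := hnorm_ge0 a; have := hnorm_ge0 b; nra.
Qed.

(** A rank one operator depends continuously on its two vectors, which gives the claim for finite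
    sums of such operators. The general case follows by density, the action being isometric. *)
Lemma hsact_continuous T g (e : R) : 0 < e ->
  \forall h \near g, hnorm (act g T - act h T) < e.
Proof.
move=> e0; have e3 : 0 < e / 3 by rewrite divr_gt0.
have [s ons hs] := hs_approx T e3.
have : orbit_continuous (finrank s T).
  by apply: orbit_continuous_sum => i; exact: orbit_continuous_rank1.
move=> /(_ g _ e3); apply: filterS => h hh.
have h1 : hnorm (act g T - act g (finrank s T)) < e / 3 by rewrite -hsactB hnorm_hsact.
have h2 : hnorm (act h (finrank s T) - act h T) < e / 3 by rewrite -hsactB hnorm_hsact hnormB.
apply: (le_lt_trans (hnormDB _ (act g (finrank s T)) _)).
apply: (le_lt_trans (lerD (lexx _) (hnormDB _ (act h (finrank s T)) _))).
by move: h1 h2 hh; lra.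
Qed.

Let conj_rep_continuous : continuous (act : G -> {ptws hsHilbert M -> hsHilbert M}).
Proof.
apply/continuous_prod => T g; apply/cvg_hnormP => e e0.
exact: hsact_continuous.
Qed.

Definition conj_rep : unitaryRep G (hsHilbert M) :=
  UnitaryRep (hsact_unitary piM) (fun g h T => hsactM piM g h T) conj_rep_continuous.

End ConjugationRep.

Section Invariant.
Variables (R : realType) (G : topologicalGroupType) (H : hilbertType R).
Variables (pi : unitaryRep G H).

Local Notation M := (compact_vectors pi).
Local Notation piM := (@compact_vectors_rep R G H pi).

(* An intertwining Hilbert-Schmidt operator is compact, so all the vectors of
   its range have totally bounded orbits. *)
Lemma conj_rep_no_invariant (T : hsHilbert M) :
  (forall g, conj_rep piM g T = T) -> T = 0.
Proof.
move=> invT.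
have comm g x : pi g ((T : hsop M) x) = (T : hsop M) (pi g x).
  by rewrite -[in RHS](invT g) /= /conj_fun repK.
have compactT x : M ((T : hsop M) x).
  apply: tbounded_approx => e e0.
  have n0 := hnorm_ge0 x; have n1 : 0 < hnorm x + 1 by lra.
  have [s ons hs] := hs_approx T (divr_gt0 e0 n1).
  exists [set y | exists2 a : H -> R[i], (forall f, f \in s -> normc (a f) <= hnorm x) &
      y = \sum_(f <- s) a f *: (T : hsop M) f].
    exact: tbounded_comb.
  move=> _ [g _ <-]; exists (finrank s T (pi g x)).
    exists (fun f => hdot (pi g x) f); last first.
      by rewrite finrankE /proj linear_map_sum //; exact: hs_linear.
    move=> f fs; rewrite (le_trans (cauchy_schwarz _ _)) // rep_hnorm.
    have -> : hnorm f = 1; last by rewrite mulr1.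
    have := hdotxx f; case: ons => _ -> //; rewrite eqxx => /complexI h.
    by apply/eqP; rewrite -(@eqrXn2 _ 2) ?hnorm_ge0 // expr1n -h.
  rewrite comm; have := hnorm_hs_apply (T - finrank s T) (pi g x).
  rewrite rep_hnorm; move/le_lt_trans; apply.
  have [x0|x0] := eqVneq (hnorm x) 0; first by rewrite x0 mulr0.
  have xp : 0 < hnorm x by rewrite lt_def x0.
  rewrite ltr_pdivlMr // in hs; have := hnorm_ge0 (T - finrank s T); nra.
apply: hsval_inj => x; apply: hnorm_eq0; apply/eqP; rewrite -sqrf_eq0 -rdotxx.
by rewrite /rdot (hs_perp _ _ (compactT x)).
Qed.

End Invariant.

(** * Unit vectors orthogonal to a proper closed subspace *)

Section Projection.
Variables (R : realType) (H : hilbertType R) (M : set H).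
Hypothesis M0 : M 0.
Hypothesis MD : forall v w, M v -> M w -> M (v + w).
Hypothesis MZ : forall c v, M v -> M (c *: v).
Hypothesis Mclosed : forall v,
  (forall e : R, 0 < e -> exists2 w, M w & hnorm (v - w) < e) -> M v.

Lemma nearest_point v : exists2 m, M m & forall w, M w -> hnorm (v - m) <= hnorm (v - w).
Proof.
have MB x y : M x -> M y -> M (x - y).
  by move=> Mx My; rewrite -scaleN1r; apply: MD => //; exact: MZ.
pose D := [set hnorm (v - w) ^+ 2 | w in M]; pose d := inf D.
have lbD : lbound D 0 by move=> _ [w _ <-]; exact: sqr_ge0.
have hiD : has_inf D by split; [exists (hnorm (v - 0) ^+ 2), 0|exists 0].
have dle w : M w -> d <= hnorm (v - w) ^+ 2 by move=> Mw; apply: (ge_inf hiD.2); exists w.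
(* The filter of near-minimizers is Cauchy: midpoints stay in [M], so the parallelogram law bounds
   the distance of two near-minimizers. *)
pose F : set_system H := filter_from [set e : R | 0 < e]
  (fun e => [set w | M w /\ hnorm (v - w) ^+ 2 < d + e]).
have FF : ProperFilter F.
  apply: filter_from_proper.
    apply: filter_from_filter; first by exists 1 => /=.
    move=> e e' /= e0 e'0; exists (Num.min e e'); first by rewrite /= lt_min e0.
    move=> w [Mw]; rewrite -ltrBlDl lt_min !ltrBlDl => /andP[h h'].
    by split.
  move=> e /= e0; have [_ [w Mw <-] h] := inf_adherent e0 hiD.
  by exists w.
have [m hm] : exists m : H, F --> m.
  apply: hilbert_cauchy => e e0; have e4 : 0 < e ^+ 2 / 4 by rewrite divr_gt0 ?exprn_gt0.
  exists [set w | M w /\ hnorm (v - w) ^+ 2 < d + e ^+ 2 / 4]; first by exists (e ^+ 2 / 4).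
  move=> x y [Mx hx] [My hy].
  have := parallelogram (v - x) (v - y).
  have -> : v - x + (v - y) = 2%:C *: (v - (2^-1)%:C *: (x + y)).
    rewrite scalerBr scalerA -rmorphM divff ?pnatr_eq0 // scale1r.
    rewrite (_ : 2%:C = 1 + 1 :> R[i]); last first.
      by rewrite -[in RHS](rmorph1 (real_complex R)) -rmorphD.
    by rewrite scalerDl scale1r opprD addrACA.
  have -> : v - x - (v - y) = y - x by rewrite opprB addrC addrA subrK.
  have Mxy : M ((2^-1)%:C *: (x + y)) by apply: MZ; exact: MD.
  rewrite hnormZr exprMn real_normK ?num_real // => h.
  rewrite hnormB -(@ltr_pXn2r _ 2) ?nnegrE ?hnorm_ge0 ?(ltW e0) //.
  by have := dle _ Mxy; lra.
have close (e : R) : 0 < e -> exists w, [/\ M w, hnorm (v - w) ^+ 2 < d + e & hnorm (m - w) < e].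
  move=> e0; have h1 : \forall w \near F, M w /\ hnorm (v - w) ^+ 2 < d + e by exists e.
  have h2 : \forall w \near F, hnorm (m - w) < e by move/cvg_hnormP: hm; apply.
  by have [w [[]]] := filter_ex (filterI h1 h2); exists w.
exists m; first by apply: Mclosed => e /close[w [Mw _ mw]]; exists w.
move=> w Mw; rewrite -(@ler_pXn2r _ 2) ?nnegrE ?hnorm_ge0 //.
rewrite (le_trans _ (dle _ Mw)) //; apply/ler_addgt0Pr => e e0.
pose n := hnorm (v - m); have n0 : 0 <= n by exact: hnorm_ge0.
(* Squaring [n - e'] costs [2 * n * e'] and the near-minimizer another [e']; the choice keeps the
   total below [e]. *)
pose e' := Num.min 1 (e / (2 * n + 2)).
have k0 : 0 < 2 * n + 2 by lra.
have e'0 : 0 < e' by rewrite lt_min ltr01 divr_gt0.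
have e'1 : e' <= 1 by rewrite ge_min lexx.
have e'2 : e' * (2 * n + 2) <= e by rewrite -ler_pdivlMr // ge_min lexx orbT.
have [w' [_ h1 h2]] := close _ e'0; rewrite -/n.
have h3 : n <= hnorm (v - w') + e'.
  rewrite (le_trans (hnormDB v w' m)) // lerD // hnormB; exact: ltW.
have h4 := hnorm_ge0 (v - w').
have [nle|/ltW ngt] := leP n e'; first by nra.
have h5 : (n - e') ^+ 2 <= hnorm (v - w') ^+ 2.
  by rewrite ler_pXn2r // ?nnegrE; lra.
by nra.
Qed.

Lemma orthogonal_exists v : ~ M v ->
  exists2 z, hnorm z = 1 & forall c, M c -> hdot z c = 0.
Proof.
move=> nMv; have [m Mm hm] := nearest_point v; pose z := v - m.
have z0 : z != 0 by apply/eqP => /eqP; rewrite subr_eq0 => /eqP vm; apply: nMv; rewrite vm.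
have zp := hnorm_gt0 z0.
have perpR c : M c -> rdot z c = 0.
  move=> Mc; have [->|c0] := eqVneq c 0; first by rewrite rdotC rdot0l.
  (* The real multiple [t] of [c] is the one nearest to [z]. Moving [m] by it cannot bring it closer
     to [v], which forces [t] to vanish. *)
  have cp := hnorm_gt0 c0; pose t := rdot z c / hnorm c ^+ 2.
  have /hm : M (m + t%:C *: c) by apply: MD => //; exact: MZ.
  rewrite opprD addrA -/z -(@ler_pXn2r _ 2) ?nnegrE ?hnorm_ge0 // (hnorm2B z) rdotZr hnormZr exprMn.
  rewrite real_normK ?num_real //.
  have tE : t * hnorm c ^+ 2 = rdot z c by rewrite /t divfK // expf_neq0 // gt_eqF.
  have -> : t ^+ 2 * hnorm c ^+ 2 = t * rdot z c by rewrite -tE; ring.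
  move=> h; have : t * rdot z c <= 0 by lra.
  rewrite -tE => h'; have : t ^+ 2 * hnorm c ^+ 2 <= 0 by move: h'; rewrite expr2 mulrA.
  rewrite pmulr_lle0 ?exprn_gt0 // => t2.
  have /eqP : t ^+ 2 = 0 by apply/eqP; rewrite eq_le t2 sqr_ge0.
  by rewrite sqrf_eq0 => /eqP ->; rewrite mul0r.
exists ((hnorm z)^-1%:C *: z); first by rewrite hnormZr ger0_norm ?invr_ge0 ?ltW // mulVf ?gt_eqF.
move=> c Mc; rewrite hdotZl hdotE perpR // (_ : rdot _ _ = 0) ?oppr0 ?mulr0 //.
have -> : rdot ('i *: z) c = rdot z (- 'i *: c).
  by rewrite rdotZ_adj; congr (rdot (_ *: _) _); apply/eqP; rewrite eq_complex /= oppr0 opprK !eqxx.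
by apply: perpR; exact: MZ.
Qed.

End Projection.

(** * Envelopes of quadratic forms *)

Section Quadratic.
Variables (R : realType) (H : hilbertType R).
Implicit Types (q D : H -> R) (v w b x y : H).

Definition quadratic q := forall x y, q (x + y) + q (x - y) = 2 * q x + 2 * q y.

Lemma quadratic0 q : quadratic q -> q 0 = 0.
Proof. by move=> /(_ 0 0); rewrite addr0 subr0; lra. Qed.

Lemma quadratic_double q x : quadratic q -> q (x + x) = 4 * q x.
Proof. by move=> hq; have := hq x x; rewrite subrr quadratic0 //; lra. Qed.

Lemma quadratic_sum I (s : seq I) (F : I -> H -> R) :
  (forall i, quadratic (F i)) -> quadratic (fun x => \sum_(i <- s) F i x).
Proof.
move=> hF x y; rewrite !mulr_sumr -!big_split; apply: eq_bigr => i _; exact: hF.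
Qed.

(** The parallelogram law alone gives no homogeneity under real scalars, but integer multiples
    suffice later. It is a second-order recursion in [k], whence the induction on two consecutive
    values. *)
Lemma quadratic_line D v b (k : nat) : quadratic D ->
  D (v + b *+ k) = D v + k%:R * (D (v + b) - D v - D b) + k%:R ^+ 2 * D b.
Proof.
move=> hD; suff : D (v + b *+ k) = D v + k%:R * (D (v + b) - D v - D b) + k%:R ^+ 2 * D b
  /\ D (v + b *+ k.+1) = D v + k.+1%:R * (D (v + b) - D v - D b) + k.+1%:R ^+ 2 * D b by case.
elim: k => [|k [IH1 IH2]].
  by rewrite !mulr0n !mulr1n addr0 expr0n expr1n /=; split; ring.
split=> //; have := hD (v + b *+ k.+1) b.
have -> : v + b *+ k.+1 + b = v + b *+ k.+2 by rewrite -addrA -mulrSr.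
have -> : v + b *+ k.+1 - b = v + b *+ k by rewrite mulrSr addrA addrK.
rewrite IH1 IH2 -!natr1; move: (D (v + b)) => d h.
by apply: (addIr (D v + k%:R * (d - D v - D b) + k%:R ^+ 2 * D b)); rewrite h; ring.
Qed.

(* A bounded quadratic form restricted to a line is a quadratic polynomial,
   so the size of its values far out controls its slope. *)
Lemma quadratic_modulus D (j : R) v b (k : nat) : quadratic D ->
  (forall x, `|D x| <= j * hnorm x ^+ 2) -> 0 <= j -> hnorm v <= 1 -> (0 < k)%N ->
  hnorm b <= k%:R^-1 -> `|D (v + b) - D v| <= 7 * j / k%:R.
Proof.
move=> hD bD j0 v1 k0 b1; have K0 : 0 < k%:R :> R by rewrite ltr0n.
have Kge1 : 1 <= k%:R :> R by rewrite ler1n.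
have kb : hnorm (b *+ k) <= 1.
  rewrite -scaler_nat -(rmorph_nat (real_complex R)) hnormZr normr_nat.
  by rewrite mulrC -ler_pdivlMr // mul1r.
have h1 : `|D (v + b *+ k)| <= 4 * j.
  rewrite (le_trans (bD _)) // mulrC ler_wpM2r //.
  have : hnorm (v + b *+ k) <= 2 by rewrite (le_trans (hnormD _ _)) // (_ : 2 = 1 + 1) ?lerD.
  by have := hnorm_ge0 (v + b *+ k); nra.
have h2 : `|D v| <= j by rewrite (le_trans (bD _)) // ler_piMr // expr_le1 ?hnorm_ge0.
have h3 : k%:R * `|D b| <= j / k%:R.
  rewrite ler_pdivlMr // mulrAC -expr2.
  have K1 : 0 <= k%:R^-1 :> R by rewrite invr_ge0 ltW.
  have b2 : hnorm b ^+ 2 <= k%:R^-1 ^+ 2 by rewrite ler_pXn2r ?nnegrE ?hnorm_ge0.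
  have := le_trans (bD b) (ler_wpM2l j0 b2).
  by rewrite exprVn ler_pdivlMr ?exprn_gt0 // mulrC.
have h4 : `|D b| <= k%:R * `|D b| by rewrite ler_peMl.
have jk : j / k%:R <= j by rewrite ler_pdivrMr // ler_peMr.
have line := quadratic_line v b k hD.
rewrite ler_pdivlMr // -[X in _ * X <= _]normr_nat -normrM.
(* The four terms on the right are at most [4 * j], [j], [j] and [j] in absolute value, whence the
   7. *)
have -> : (D (v + b) - D v) * k%:R =
  D (v + b *+ k) - D v + (k%:R * D b - k%:R * (k%:R * D b)).
  by rewrite line; ring.
have := ler_normD (D (v + b *+ k) - D v) (k%:R * D b - k%:R * (k%:R * D b)).
have := ler_normB (D (v + b *+ k)) (D v).
have := ler_normB (k%:R * D b) (k%:R * (k%:R * D b)).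
rewrite !normrM !normr_nat.
have : k%:R * (k%:R * `|D b|) <= j by rewrite mulrC -ler_pdivlMr.
lra.
Qed.

(* For [q v = <X v, v>] this Moreau envelope is the quadratic form of
   [A / (1 + A)] with [A = X / t], written as an infimum so that it is visibly monotone and
   concave in [q]; no functional calculus is needed. *)
Definition envelope q (t : R) v : R := inf [set q w / t + hnorm (v - w) ^+ 2 | w in setT].

Section Envelope.
Variable q : H -> R.
Hypothesis q_ge0 : forall v, 0 <= q v.

Let term_ge0 t v w : 0 < t -> 0 <= q w / t + hnorm (v - w) ^+ 2.
Proof. by move=> t0; rewrite addr_ge0 ?sqr_ge0 // divr_ge0 // ltW. Qed.

Lemma envelope_le t v w : 0 < t -> envelope q t v <= q w / t + hnorm (v - w) ^+ 2.
Proof.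
move=> t0; apply: ge_inf; last by exists w.
by exists 0 => _ [w' _ <-]; exact: term_ge0.
Qed.

Lemma envelope_ge t v c : (forall w, c <= q w / t + hnorm (v - w) ^+ 2) -> c <= envelope q t v.
Proof.
move=> h; apply: lb_le_inf; first by exists (q 0 / t + hnorm (v - 0) ^+ 2), 0.
by move=> _ [w _ <-].
Qed.

Lemma envelope_adherent t v (e : R) : 0 < t -> 0 < e ->
  exists w, q w / t + hnorm (v - w) ^+ 2 < envelope q t v + e.
Proof.
move=> t0 e0; have [|_ [w _ <-] h] := @inf_adherent R
  [set q w / t + hnorm (v - w) ^+ 2 | w in setT] e e0; last by exists w.
split; first by exists (q 0 / t + hnorm (v - 0) ^+ 2), 0.
by exists 0 => _ [w' _ <-]; exact: term_ge0.
Qed.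

Lemma envelope_ge0 t v : 0 < t -> 0 <= envelope q t v.
Proof. by move=> t0; apply: envelope_ge => w; exact: term_ge0. Qed.

Lemma envelope_le_form t v : 0 < t -> envelope q t v <= q v / t.
Proof. by move=> t0; have := envelope_le v v t0; rewrite subrr hnorm0 expr0n addr0. Qed.

Hypothesis quad_q : quadratic q.

Lemma envelope_le_hnorm t v : 0 < t -> envelope q t v <= hnorm v ^+ 2.
Proof. by move=> t0; have := envelope_le v 0 t0; rewrite quadratic0 // mul0r add0r subr0. Qed.

(** Adding and subtracting near-minimizers for [x] and [y] gives one inequality of the parallelogram
    law. The other is the same inequality for [x + y] and [x - y], combined with [double]. *)
Lemma envelope_quadratic t : 0 < t -> quadratic (envelope q t).
Proof.
move=> t0.
have half x y :
    envelope q t (x + y) + envelope q t (x - y) <= 2 * envelope q t x + 2 * envelope q t y.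
  apply/ler_addgt0Pr => e e0; have e4 : 0 < e / 4 by rewrite divr_gt0.
  have [w hw] := envelope_adherent x t0 e4; have [w' hw'] := envelope_adherent y t0 e4.
  have h1 := envelope_le (x + y) (w + w') t0; have h2 := envelope_le (x - y) (w - w') t0.
  have E1 : x + y - (w + w') = (x - w) + (y - w') by rewrite opprD addrACA.
  have E2 : x - y - (w - w') = (x - w) - (y - w').
    by rewrite !opprB [w' - w]addrC addrACA [- y + w']addrC.
  have := parallelogram (x - w) (y - w'); rewrite -E1 -E2 => hp.
  have hq : q (w + w') / t + q (w - w') / t = 2 * (q w / t) + 2 * (q w' / t).
    by rewrite -mulrDl quad_q; ring.
  lra.
have double x : 4 * envelope q t x <= envelope q t (x + x).
  apply: envelope_ge => w; pose w2 := (2^-1)%:C *: w.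
  have wE : w = w2 + w2.
    by rewrite -scalerDl -rmorphD (_ : 2^-1 + 2^-1 = 1 :> R) ?scale1r //; field.
  have E : x + x - w = (x - w2) + (x - w2) by rewrite {1}wE opprD addrACA.
  have := envelope_le x w2 t0; rewrite {1}wE quadratic_double // E.
  have -> : hnorm (x - w2 + (x - w2)) ^+ 2 = 4 * hnorm (x - w2) ^+ 2.
    have := parallelogram (x - w2) (x - w2); rewrite subrr hnorm0 expr0n /=; lra.
  lra.
move=> x y; apply/eqP; rewrite eq_le half /=.
have := half (x + y) (x - y).
have -> : x + y + (x - y) = x + x by rewrite addrACA subrr addr0.
have -> : x + y - (x - y) = y + y by rewrite opprB [x + y]addrC addrACA subrr addr0.
by have := double x; have := double y; lra.
Qed.

(** By monotonicity it is enough to treat the rank one form [c * rdot w v ^+ 2], where the bound is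
    A / (1 + A) for A = c / t. *)
Lemma envelope_lower t v (c : R) : 0 < t -> 0 < c -> hnorm v = 1 ->
  (forall w, c * rdot w v ^+ 2 <= q w) -> c / (c + t) <= envelope q t v.
Proof.
move=> t0 c0 v1 hq; apply: envelope_ge => w.
have h1 : rdot (v - w) v ^+ 2 <= hnorm (v - w) ^+ 2.
  have := abs_rdot_le (v - w) v; rewrite v1 mulr1 => h.
  by rewrite -(real_normK (num_real (rdot _ _))) ler_pXn2r ?nnegrE ?hnorm_ge0.
rewrite rdotBl rdotxx v1 expr1n in h1; set x := rdot w v in h1.
have h2 : c / t * x ^+ 2 <= q w / t by rewrite mulrAC ler_pM2r ?invr_gt0 // hq.
rewrite (le_trans _ (lerD h2 h1)) // ler_pdivrMr ?addr_gt0 //.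
rewrite -(ler_pM2l t0).
have -> : t * ((c / t * x ^+ 2 + (1 - x) ^+ 2) * (c + t)) =
  (c * x ^+ 2 + t * (1 - x) ^+ 2) * (c + t) by field; rewrite gt_eqF.
(* Completing the square: the minimum is at x = t / (c + t). *)
have -> : (c * x ^+ 2 + t * (1 - x) ^+ 2) * (c + t) = t * c + ((c + t) * x - t) ^+ 2 by ring.
by rewrite lerDl sqr_ge0.
Qed.

End Envelope.

End Quadratic.

(** * The truncated logarithm: bounded increments and negative average *)

Section LogDensity.
Variables (R : realType) (G : topologicalGroupType) (H : hilbertType R).
Variables (pi : unitaryRep G H) (S : seq G) (q : H -> R) (lam : R).
Hypothesis SV : forall s, s \in S -> s^-1%g \in S.
Hypothesis lam0 : 0 < lam.
Hypothesis lam1 : lam < 1.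
Hypothesis q_ge0 : forall v, 0 <= q v.
Hypothesis quad_q : quadratic q.
Hypothesis q_le : forall v, q v <= hnorm v ^+ 2.
Hypothesis q_avg : forall w, \sum_(s <- S) q (pi s w) <= (size S)%:R * lam * q w.
Variable J : nat.
Hypothesis SJ : (size S)%:R * lam ^+ J <= 1.
Implicit Types (v w : H) (t : R).

Let lamX k : 0 < lam ^+ k. Proof. exact: exprn_gt0. Qed.

(* Up to normalization, a truncation of [<log X v, v>] where [q v = <X v, v>]:
   replacing [q] by [lam * q] shifts the index, so the sum telescopes. *)
Definition log_density m v : R := \sum_(k < m) envelope q (lam ^+ k) v.

(** Concavity and monotonicity in one stroke: for each [w], the point [pi s w] is tried in the
    infimum at [pi s v]. The distance term does not change, and the forms add up to what [q_avg]
    bounds. *)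
Lemma envelope_avg t v : 0 < t ->
  \sum_(s <- S) envelope q t (pi s v) <= (size S)%:R * envelope q (t / lam) v.
Proof.
move=> t0; have [->|Sn0] := eqVneq S [::]; first by rewrite big_nil mul0r.
have N0 : 0 < (size S)%:R :> R by rewrite ltr0n lt0n size_eq0.
rewrite -ler_pdivrMl //; apply: envelope_ge => w; rewrite ler_pdivrMl //.
apply: (@le_trans _ _ (\sum_(s <- S) (q (pi s w) / t + hnorm (v - w) ^+ 2))).
  by apply: ler_sum => s _; rewrite -(rep_hnormB pi s) envelope_le.
rewrite big_split /= big_const_seq count_predT iter_addr_0 -mulr_suml.
rewrite -[_ *+ size S]mulr_natl mulrDr lerD2r ler_pdivrMr //.
rewrite (le_trans (q_avg w)) // invfM invrK le_eqVlt; apply/orP; left; apply/eqP.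
by field; rewrite gt_eqF.
Qed.

(** All terms of the sum in [q_avg] are nonnegative, so each of them is at most [(size S)%:R * q w],
    and [SJ] absorbs this factor into [J] powers of [lam]. *)
Lemma envelope_shift t s v : s \in S -> 0 < t ->
  envelope q t (pi s v) <= envelope q (t * lam ^+ J) v.
Proof.
move=> sS t0; apply: envelope_ge => w.
have h := envelope_le q_ge0 (pi s v) (pi s w) t0; rewrite rep_hnormB in h.
rewrite (le_trans h) // lerD2r ler_pdivrMr // invfM mulrA mulrAC divfK ?gt_eqF //.
rewrite ler_pdivlMr //.
have h1 : q (pi s w) <= (size S)%:R * lam * q w.
  rewrite (le_trans _ (q_avg w)) // (big_rem s sS) /= lerDl sumr_ge0 //.
have h2 : q (pi s w) <= (size S)%:R * q w.
  rewrite (le_trans h1) // ler_wpM2r // ler_piMr ?ler0n // ltW //.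
have := ler_wpM2r (ltW (lamX J)) h2; move/le_trans; apply.
by rewrite mulrAC ler_piMl.
Qed.

Lemma log_density_quadratic m : quadratic (log_density m).
Proof. by apply: quadratic_sum => k; apply: envelope_quadratic. Qed.

(** After a shift of the index by [J], only the [J] terms beyond [m] are new, each at most
    [hnorm v ^+ 2]. The bound does not involve [m]. *)
Let log_density_shift m s v : s \in S ->
  log_density m (pi s v) <= log_density m v + J%:R * hnorm v ^+ 2.
Proof.
move=> sS; pose f k := envelope q (lam ^+ k) v.
have f0 k : 0 <= f k by apply: envelope_ge0.
have -> : log_density m v = \sum_(0 <= k < m) f k by rewrite big_mkord.
apply: (@le_trans _ _ (\sum_(0 <= k < m) f (k + J)%N)).
  rewrite big_mkord; apply: ler_sum => k _; rewrite /f exprD; exact: envelope_shift.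
have -> : \sum_(0 <= k < m) f (k + J)%N = \sum_(J <= k < m + J) f k.
  by rewrite -{2}(add0n J) big_addn addnK.
have h : \sum_(J <= k < m + J) f k <= \sum_(0 <= k < m + J) f k.
  by rewrite [leRHS](big_cat_nat (n := J)) ?leq_addl //= lerDr sumr_ge0.
rewrite (le_trans h) // (big_cat_nat (n := m)) ?leq_addr //= lerD2l.
rewrite (le_trans (ler_sum _ (G := fun=> hnorm v ^+ 2) _)) //.
  by move=> k _; apply: envelope_le_hnorm.
by rewrite sumr_const_nat addKn mulr_natl.
Qed.

Lemma log_density_diff m s v : s \in S ->
  `|log_density m (pi s v) - log_density m v| <= J%:R * hnorm v ^+ 2.
Proof.
move=> sS; have h1 := log_density_shift m v sS.
have := log_density_shift m (pi s v) (SV sS); rewrite repK rep_hnorm => h2.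
by rewrite ler_norml; apply/andP; split; lra.
Qed.

(** Averaging lowers the index by one, so the difference telescopes to two end terms: the new one at
    [lam^-1] is at most [lam], and the lost one at [lam ^+ m] is at least [(1 + lam) / 2] for the
    given [m]. *)
Lemma log_density_avg m v (c : R) : hnorm v = 1 -> 0 < c ->
  (forall w, c * rdot w v ^+ 2 <= q w) -> lam ^+ m <= c * (1 - lam) / 2 ->
  \sum_(s <- S) (log_density m.+1 (pi s v) - log_density m.+1 v)
    <= - ((size S)%:R * (1 - lam) / 2).
Proof.
move=> v1 c0 hc hm.
have h1 : \sum_(s <- S) log_density m.+1 (pi s v) <=
    (size S)%:R * \sum_(k < m.+1) envelope q (lam ^+ k / lam) v.
  rewrite /log_density exchange_big mulr_sumr /=; apply: ler_sum => k _; exact: envelope_avg.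
have h2 : \sum_(k < m.+1) envelope q (lam ^+ k / lam) v =
    envelope q lam^-1 v + log_density m.+1 v - envelope q (lam ^+ m) v.
  rewrite big_ord_recl expr0 mul1r /log_density big_ord_recr /= addrA addrK.
  by congr (_ + _); apply: eq_bigr => k _; rewrite /= /bump add1n exprSr mulfK // gt_eqF.
have h3 : envelope q lam^-1 v <= lam.
  rewrite (le_trans (envelope_le_form q_ge0 _ _)) ?invr_gt0 // invrK -[leRHS]mul1r ler_pM2r //.
  by rewrite (le_trans (q_le v)) // v1 expr1n.
have h4 : (1 + lam) / 2 <= envelope q (lam ^+ m) v.
  rewrite (le_trans _ (envelope_lower _ c0 v1 hc)) // ler_pdivlMr ?addr_gt0 //.
  by have := lamX m; nra.
rewrite sumrB big_const_seq count_predT iter_addr_0 -[_ *+ size S]mulr_natl.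
rewrite (le_trans (lerB h1 (lexx _))) // h2 -mulrBr -mulrA -mulrN ler_wpM2l ?ler0n //.
lra.
Qed.

End LogDensity.

(** * Spectral gap and supersolutions *)

Section FixedPoint.
Variables (R : realType) (K : hilbertType R).

Lemma small_power (r e : R) : 0 <= r -> r < 1 -> 0 < e -> exists n, r ^+ n < e.
Proof.
move=> r0 r1 e0; have h : `|r| < 1 by rewrite ger0_norm.
have /cvgrPdist_lt /(_ e e0) [n _ hn] := cvg_expr h.
exists n; have := hn n (leqnn n); rewrite /= sub0r normrN ger0_norm //.
exact: exprn_ge0.
Qed.

(** Almost fixed points form a Cauchy filter, since [(1 - k) * hnorm (x - y)] is at most the sum of
    the displacements of [x] and [y]. *)
Lemma contraction_fixed_point (U : set K) (f : K -> K) (k : R) :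
  0 <= k -> k < 1 -> (exists x, U x) -> (forall x, U x -> U (f x)) ->
  (forall x y, hnorm (f x - f y) <= k * hnorm (x - y)) ->
  (forall x, (forall e : R, 0 < e -> exists2 y, U y & hnorm (x - y) < e) -> U x) ->
  exists2 x, U x & f x = x.
Proof.
move=> k0 k1 [a Ua] Uf fk Ucl.
pose F : set_system K := filter_from [set e : R | 0 < e]
  (fun e => [set x | U x /\ hnorm (f x - x) < e]).
have FF : ProperFilter F.
  apply: filter_from_proper.
    apply: filter_from_filter; first by exists 1 => /=.
    move=> e e' /= e0 e'0; exists (Num.min e e'); first by rewrite /= lt_min e0.
    by move=> x [Ux]; rewrite lt_min => /andP[h h']; split.
  move=> e /= e0; pose d := hnorm (f a - a) + 1.
  have d0 : 0 < d by have := hnorm_ge0 (f a - a); rewrite /d; lra.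
  have [n hn] := small_power k0 k1 (divr_gt0 e0 d0).
  exists (iter n f a); split; first by elim: n {hn} => //= n; exact: Uf.
  apply: (@le_lt_trans _ _ (k ^+ n * d)); last by rewrite -ltr_pdivlMr.
  elim: n {hn} => [|n IH] /=; first by rewrite mul1r /d lerDl.
  by rewrite (le_trans (fk _ _)) // exprS -mulrA ler_wpM2l.
have [x hx] : exists x : K, F --> x.
  apply: hilbert_cauchy => e e0; have e1 : 0 < e * (1 - k) / 2.
    by rewrite divr_gt0 // mulr_gt0 // subr_gt0.
  exists [set x | U x /\ hnorm (f x - x) < e * (1 - k) / 2]; first by exists (e * (1 - k) / 2).
  move=> x y [_ hx] [_ hy].
  have h1 := hnormDB x (f x) y; have h2 := hnormDB (f x) (f y) y.
  have h3 := fk x y; rewrite hnormB in hx.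
  have : (1 - k) * hnorm (x - y) < (1 - k) * e by lra.
  by rewrite ltr_pM2l // subr_gt0.
have close (e : R) : 0 < e -> exists y, [/\ U y, hnorm (f y - y) < e & hnorm (x - y) < e].
  move=> e0; have h1 : \forall y \near F, U y /\ hnorm (f y - y) < e by exists e.
  have h2 : \forall y \near F, hnorm (x - y) < e by move/cvg_hnormP: hx; apply.
  by have [y [[]]] := filter_ex (filterI h1 h2); exists y.
exists x; first by apply: Ucl => e /close[y [Uy _ xy]]; exists y.
apply/eqP; rewrite -subr_eq0; apply/eqP; apply: hnorm_eq0; apply/eqP.
rewrite eq_le hnorm_ge0 andbT; apply/ler_addgt0Pr => e e0; rewrite add0r.
have [y [_ h1 h2]] := close _ (divr_gt0 e0 (ltr0n R 3)).
have h3 := hnormDB (f x) (f y) x; have h4 := hnormDB (f y) y x; have h5 := fk x y.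
have h6 : k * hnorm (x - y) <= hnorm (x - y) by rewrite ler_piMl ?hnorm_ge0 // ltW.
by rewrite (hnormB y) in h4; lra.
Qed.

End FixedPoint.

Section SpectralGap.
Variables (R : realType) (G : topologicalGroupType) (K : hilbertType R).
Variables (rho : unitaryRep G K) (Q : seq G) (eps : R).
Hypothesis eps0 : 0 < eps.
Hypothesis eps1 : eps <= 1.
Hypothesis gap : forall v, v != 0 -> exists2 g, g \in Q & eps * hnorm v <= hnorm (v - rho g v).

(** The identity is included so that the sum over the list contains [v + rho g v] for the element
    [g] that moves [v]: this pair is shorter than [2 * hnorm v]. *)
Definition symgen : seq G := 1%g :: Q ++ [seq g^-1%g | g <- Q].

Lemma symgenV s : s \in symgen -> s^-1%g \in symgen.
Proof.
rewrite !inE !mem_cat => /orP[/eqP->|/orP[sQ|/mapP[g gQ ->]]].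
- by rewrite invg1 eqxx.
- by rewrite (map_f _ sQ) !orbT.
- by rewrite invgK gQ orbT.
Qed.

Lemma symgen_perm : perm_eq [seq g^-1%g | g <- symgen] symgen.
Proof.
rewrite /symgen /= invg1 perm_cons map_cat perm_catC -map_comp.
by rewrite (eq_map (g := id)) ?map_id // => g /=; rewrite invgK.
Qed.

(** By the parallelogram law, [hnorm (v + rho g v) ^+ 2] is at most [(4 - eps ^+ 2) * hnorm v ^+ 2],
    and 4 - eps^2 <= (2 - eps^2 / 4)^2. The element [g] varies with [v], the constant does not. *)
Lemma hnorm_avg_le v : hnorm (\sum_(s <- symgen) rho s v) <=
  ((size symgen)%:R - eps ^+ 2 / 4) * hnorm v.
Proof.
have [->|v0] := eqVneq v 0.
  by rewrite big1 ?hnorm0 ?mulr0 // => s _; rewrite linear_map0 //; exact: rep_linear.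
have [g gQ hg] := gap v0.
have gS : g \in Q ++ [seq g^-1%g | g <- Q] by rewrite mem_cat gQ.
rewrite big_cons rep1 (big_rem g gS) /= addrA (le_trans (hnormD _ _)) //.
set T := rem g _.
have hT : hnorm (\sum_(s <- T) rho s v) <= (size T)%:R * hnorm v.
  elim: T => [|s T IH]; first by rewrite big_nil hnorm0 mul0r.
  by rewrite big_cons (le_trans (hnormD _ _)) // rep_hnorm /= -natr1 mulrDl mul1r addrC lerD2r.
have sT : (size (Q ++ [seq g^-1%g | g <- Q])).+1 = (size T).+2.
  by rewrite /T size_rem //; case: (Q ++ _) gS.
have h : hnorm (v + rho g v) <= (2 - eps ^+ 2 / 4) * hnorm v.
  rewrite -(@ler_pXn2r _ 2) ?nnegrE ?mulr_ge0 ?hnorm_ge0 //; last first.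
    by have := eps0; have := eps1; nra.
  have := parallelogram v (rho g v); rewrite rep_hnorm => hp.
  have : (eps * hnorm v) ^+ 2 <= hnorm (v - rho g v) ^+ 2.
    by rewrite ler_pXn2r ?nnegrE ?mulr_ge0 ?hnorm_ge0 ?(ltW eps0).
  rewrite !exprMn; have := mulr_ge0 (sqr_ge0 (eps ^+ 2)) (sqr_ge0 (hnorm v)).
  by move: (hnorm (v + _)) (hnorm (v - _)) (hnorm v) hp => a b c; nra.
rewrite sT -addn2 natrD (le_trans (lerD h hT)) // le_eqVlt; apply/orP; left; apply/eqP.
by ring.
Qed.

End SpectralGap.

Section AlmostInvariant.
Variables (R : realType) (G : topologicalGroupType) (H : hilbertType R).
Variables (pi : unitaryRep G H) (Q : seq G) (eps : R) (z : H).

Local Notation M := (compact_vectors pi).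
Local Notation piM := (@compact_vectors_rep R G H pi).
Local Notation S := (symgen Q).
Local Notation N := (size S).

Hypothesis eps0 : 0 < eps.
Hypothesis eps1 : eps <= 1.
Hypothesis gap : forall T : hsHilbert M, T != 0 ->
  exists2 g, g \in Q & eps * hnorm T <= hnorm (T - conj_rep piM g T).
Hypothesis z1 : hnorm z = 1.
Hypothesis zM : perp M z.

Let form (X : hsHilbert M) v := rdot ((X : hsop M) v) v.

Let N0 : 0 < N%:R :> R. Proof. by rewrite ltr0n. Qed.

(** [mu] bounds the norm of the average over the symmetrized Kazhdan set; [lam] is halfway from it
    to 1, so that the average divided by [lam] still contracts. *)
Let mu := 1 - eps ^+ 2 / 4 / N%:R.
Let lam := (1 + mu) / 2.

Let muN : N%:R * mu = N%:R - eps ^+ 2 / 4.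
Proof. by rewrite /mu mulrBr mulr1 mulrC divfK // gt_eqF. Qed.

Let mu1 : mu < 1.
Proof. by rewrite /mu ltrBlDr ltrDl !divr_gt0 // exprn_gt0. Qed.

Let mu0 : 0 <= mu.
Proof.
rewrite /mu subr_ge0 ler_pdivrMr // mul1r.
have : 1 <= N%:R :> R by rewrite ler1n.
by have := eps0; have := eps1; nra.
Qed.

Let lam0 : 0 < lam. Proof. by rewrite /lam; have := mu0; lra. Qed.
Let lam1 : lam < 1. Proof. by rewrite /lam; have := mu1; lra. Qed.
Let mulam : mu < lam. Proof. by rewrite /lam; have := mu1; lra. Qed.

Let formD X Y v : form (X + Y) v = form X v + form Y v.
Proof. by rewrite /form -rdotDl. Qed.

Let formZ (r : R) X v : form (r%:C *: X) v = r * form X v.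
Proof. by rewrite /form -rdotZl. Qed.

Let form_sum I (s : seq I) (F : I -> hsHilbert M) v :
  form (\sum_(i <- s) F i) v = \sum_(i <- s) form (F i) v.
Proof. by rewrite /form hs_sumE rdot_suml. Qed.

Let form_act g X v : form (hsact piM g X) v = form X (pi g^-1%g v).
Proof. by rewrite /form -[LHS]/(rdot (pi g _) v) /rdot rep_hdotV. Qed.

Let form_quadratic X : quadratic (form X).
Proof.
move=> x y; rewrite /form linear_mapD; last exact: hs_linear.
rewrite linear_mapB; last exact: hs_linear.
by rewrite !(rdotDl, rdotDr, rdotNl, rdotNr); ring.
Qed.

Let form_le X v : `|form X v| <= hnorm X * hnorm v ^+ 2.
Proof.
rewrite (le_trans (abs_rdot_le _ _)) // expr2 mulrA ler_wpM2r ?hnorm_ge0 //.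
exact: hnorm_hs_apply.
Qed.

Let orbit_rank1 g := rank1 (pi g z) (perp_rep piM g zM).

Let form_rank1 g v : form (orbit_rank1 g) v = normc (hdot v (pi g z)) ^+ 2.
Proof.
rewrite /form -[LHS]/(rdot (hdot v (pi g z) *: pi g z) v) /rdot hdotZl.
by rewrite [X in _ * X]hdotC mulrC mulJc.
Qed.

(* The operator [X] solves [X = T + (N lam)^-1 sum_s s X s^-1], where [T] is a sum
   of projections onto vectors of the orbit of [z]. *)
Lemma supersolution (F : seq G) : exists2 X : hsHilbert M,
  (forall v, 0 <= form X v) &
  forall v, form X v = \sum_(g <- F) normc (hdot v (pi g z)) ^+ 2 +
    (N%:R * lam)^-1 * \sum_(s <- S) form X (pi s v).
Proof.
pose c := (N%:R * lam)^-1.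
have c0 : 0 < c by rewrite invr_gt0 mulr_gt0.
pose L (X : hsHilbert M) : hsHilbert M := \sum_(s <- S) hsact piM s X.
pose f (X : hsHilbert M) : hsHilbert M := \sum_(g <- F) orbit_rank1 g + c%:C *: L X.
have LB X Y : L X - L Y = L (X - Y).
  by rewrite /L -sumrB; apply: eq_bigr => s _; rewrite hsactB.
have formf X v : form (f X) v = \sum_(g <- F) normc (hdot v (pi g z)) ^+ 2 +
    c * \sum_(s <- S) form X (pi s v).
  rewrite /f formD form_sum formZ /L form_sum; congr (_ + c * _).
    by apply: eq_bigr => g _; exact: form_rank1.
  (* The action puts [s^-1] into the argument of the form; symmetry of the list turns it back into
     [s]. *)
  rewrite -[RHS](perm_big _ (symgen_perm Q)) big_map.
  by apply: eq_bigr => s _; exact: form_act.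
have [X posX fX] : exists2 X, (forall v, 0 <= form X v) & f X = X.
  (* The positive operators form a nonempty closed set preserved by [f], so the fixed point is
     positive; the contraction constant is [c] times the bound [N%:R * mu] for [L]. *)
  apply: (@contraction_fixed_point R (hsHilbert M) [set X | forall v, 0 <= form X v] f (mu / lam)).
  - by rewrite divr_ge0 // ltW.
  - by rewrite ltr_pdivrMr // mul1r.
  - by exists 0 => v; rewrite /form -[X in rdot X _]/(0 : H) rdot0l.
  - move=> X hX v; rewrite formf addr_ge0 ?sumr_ge0 // => [g _|]; first exact: sqr_ge0.
    by rewrite mulr_ge0 ?(ltW c0) // sumr_ge0.
  - move=> X Y; rewrite /f opprD addrACA subrr add0r -scalerBr LB hnormZr ger0_norm ?(ltW c0) //.
    have := hnorm_avg_le eps0 eps1 gap (X - Y); rewrite -muN => h.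
    rewrite (le_trans (ler_wpM2l (ltW c0) h)) // le_eqVlt; apply/orP; left; apply/eqP.
    by rewrite /c; field; rewrite !gt_eqF.
  - move=> X hX v; apply/ler_addgt0Pr => e e0.
    have n0 := sqr_ge0 (hnorm v); have k0 : 0 < hnorm v ^+ 2 + 1 by lra.
    have [Y hY XY] := hX _ (divr_gt0 e0 k0).
    have h1 := hY v; have h2 := form_le (X - Y) v.
    have h3 : form X v = form Y v + form (X - Y) v by rewrite -formD addrC subrK.
    have h4 : hnorm (X - Y) * hnorm v ^+ 2 <= e.
      rewrite ltr_pdivlMr // in XY; have := hnorm_ge0 (X - Y); nra.
    by move: h2; rewrite ler_norml => /andP[h2 _]; lra.
by exists X => // v; rewrite -{1}fX formf.
Qed.

(** The order of the quantifiers matters: [J] and [d] come from [lam] and the number of generators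
    only. The norm of [X] and the truncation [m] depend on [F], but do not appear in the bounds,
    which allows a limit over all finite [F]. *)
Lemma exists_log_density : exists (J : nat) (d : R), 0 < d /\
  forall F : seq G, exists D : H -> R, [/\ quadratic D,
    forall s v, s \in S -> `|D (pi s v) - D v| <= J%:R * hnorm v ^+ 2 &
    forall g, g \in F -> \sum_(s <- S) (D (pi s (pi g z)) - D (pi g z)) <= - d].
Proof.
have [J hJ] := small_power (ltW lam0) lam1 (divr_gt0 ltr01 N0).
exists J, (N%:R * (1 - lam) / 2); split.
  by rewrite divr_gt0 // mulr_gt0 // subr_gt0.
move=> F; have [X posX hX] := supersolution F.
have X0 : 0 < hnorm X + 1 by rewrite ltr_wpDl ?hnorm_ge0.
pose q v := form X v / (hnorm X + 1).
have q0 v : 0 <= q v by rewrite divr_ge0 // ltW.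
have qq : quadratic q by move=> x y; rewrite /q -mulrDl form_quadratic; ring.
have qn v : q v <= hnorm v ^+ 2.
  rewrite ler_pdivrMr // mulrC; have := form_le X v; rewrite ger0_norm // => h.
  by rewrite (le_trans h) // ler_wpM2r ?sqr_ge0 // lerDl.
have qa w : \sum_(s <- S) q (pi s w) <= N%:R * lam * q w.
  have nl0 : 0 < N%:R * lam by rewrite mulr_gt0.
  (* The equation for [X] multiplied by [N%:R * lam]; dropping its nonnegative source term leaves
     the averaged inequality. *)
  have e : N%:R * lam * form X w = N%:R * lam * \sum_(g <- F) normc (hdot w (pi g z)) ^+ 2 +
      \sum_(s <- S) form X (pi s w).
    rewrite [form X w]hX; move: (\sum_(g <- F) _) (\sum_(s <- S) _) => a b.
    by rewrite (mulrDr (N%:R * lam)) mulVKf // gt_eqF.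
  rewrite /q -mulr_suml mulrA ler_pM2r ?invr_gt0 // e lerDr mulr_ge0 ?(ltW nl0) //.
  by rewrite sumr_ge0 // => g _; exact: sqr_ge0.
have hJ' : N%:R * lam ^+ J <= 1 by move: hJ; rewrite ltr_pdivlMr // mulrC => /ltW.
have d0 : 0 < (hnorm X + 1)^-1 * (1 - lam) / 2.
  by rewrite divr_gt0 // mulr_gt0 ?invr_gt0 // subr_gt0.
have [m hm] := small_power (ltW lam0) lam1 d0.
exists (log_density q lam m.+1); split.
- exact: log_density_quadratic.
- by move=> s v sS; exact: (log_density_diff (@symgenV _ Q) lam0 lam1 q0 qq qa hJ').
- move=> g gF; have c0 : 0 < (hnorm X + 1)^-1 by rewrite invr_gt0.
  apply: (log_density_avg lam0 q0 qn qa (etrans (rep_hnorm pi g z) z1) c0 _ (ltW hm)) => w.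
  rewrite mulrC ler_pM2r // hX (big_rem g gF) /= -addrA ler_wpDr //.
    rewrite addr_ge0 ?sumr_ge0 // => [i _|]; first exact: sqr_ge0.
    by rewrite mulr_ge0 ?sumr_ge0 // ltW // invr_gt0 mulr_gt0.
  by rewrite normc_sqr lerDl sqr_ge0.
Qed.

End AlmostInvariant.

(** * Invariant measures on a compact space of cocycles *)

Section BorelIntegral.
Variables (R : realType) (X : ptopologicalType).
Implicit Types (f g : borel X -> R) (mu : probability (borel X) R).

Lemma continuous_borel_measurable (f : X -> R) :
  continuous f -> measurable_fun [set: borel X] (f : borel X -> R).
Proof.
move=> /continuousP cf; apply: (measurability _ (RGenOpens.measurableE R)).
move=> _ [_ [a [b ->] <-]]; rewrite setTI; apply: sub_gen_smallest.
by apply: cf; exact: interval_open.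
Qed.

Lemma homeo_borel_measurable (h : X -> X) :
  continuous h -> measurable_fun [set: borel X] (h : borel X -> borel X).
Proof.
move=> /continuousP ch; apply: (@measurability _ _ (borel X) (borel X) setT h (@open X)) => //.
by move=> _ [U oU <-]; rewrite setTI; apply: sub_gen_smallest; exact: ch.
Qed.

Lemma bounded_integrable mu (f : X -> R) (C : R) : continuous f ->
  (forall x, `|f x| <= C) -> mu.-integrable [set: borel X] (EFin \o f).
Proof.
move=> cf bf; apply: measurable_bounded_integrable => //.
- by apply: (le_lt_trans (probability_le1 mu measurableT)); exact: ltry.
- exact: continuous_borel_measurable.
- exists C; split; first exact: num_real.
  by move=> M CM x _; exact: (le_trans (bf x) (ltW CM)).
Qed.

Lemma Rintegral_invariant mu (h : X -> X) (f : X -> R) (C : R) :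
  continuous h -> (forall A : set (borel X), measurable A -> mu (h @^-1` A) = mu A) ->
  continuous f -> (forall x, `|f x| <= C) ->
  Rintegral mu setT (f \o h) = Rintegral mu setT f.
Proof.
move=> ch inv cf bf; have mh := homeo_borel_measurable ch.
have mf := continuous_borel_measurable cf.
rewrite /Rintegral; congr fine.
have cfh : continuous (f \o h) by move=> x; apply: continuous_comp; [exact: ch|exact: cf].
have ifh : mu.-integrable [set: borel X] ((EFin \o f) \o h).
  by apply: (@bounded_integrable mu (f \o h) C) => // x; exact: bf.
have mEf := iffRL (measurable_EFinP _ _) mf.
have /= <- := @integral_pushforward _ _ (borel X) (borel X) R h mh mu setT _ mEf ifh measurableT.
by apply: eq_measure_integral => A mA _; exact: inv.
Qed.

Lemma Rintegral_sum mu I (s : seq I) (F : I -> X -> R) (C : I -> R) :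
  (forall i, continuous (F i)) -> (forall i x, `|F i x| <= C i) ->
  Rintegral mu setT (fun x => \sum_(i <- s) F i x) = \sum_(i <- s) Rintegral mu setT (F i).
Proof.
move=> cF bF.
have cont t : continuous (fun x => \sum_(i <- t) F i x).
  by move=> x; apply: cvg_sum_seq => i; exact: cF.
have bound t x : `|\sum_(i <- t) F i x| <= \sum_(i <- t) C i.
  elim: t => [|i t IH]; first by rewrite !big_nil normr0.
  by rewrite !big_cons (le_trans (ler_normD _ _)) // lerD.
elim: s => [|i s IH].
  rewrite big_nil; under eq_Rintegral do rewrite big_nil.
  by rewrite Rintegral_cst // mul0r.
rewrite big_cons -IH; under eq_Rintegral do rewrite big_cons.
rewrite RintegralD //.
  by apply: bounded_integrable (cF i) (bF i).
exact: bounded_integrable (cont s) (bound s).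
Qed.

End BorelIntegral.

Section PointedSubtype.
Variables (T : topologicalType) (A : set T) (x0 : A).

(* The argument [x0] only provides the base point. *)
Definition pointed_subtype : Type := let _ := x0 in set_type A.

HB.instance Definition _ := Topological.copy pointed_subtype (set_type A).
HB.instance Definition _ := isPointed.Build pointed_subtype x0.

Definition subtype_val (x : pointed_subtype) : T := set_val (x : A).

Lemma subtype_valP x : A (subtype_val x).
Proof. by rewrite /subtype_val; exact: set_valP. Qed.

Lemma subtype_val_continuous : continuous subtype_val.
Proof. exact: initial_continuous. Qed.

Lemma subtype_val_inj : injective subtype_val.
Proof. exact: val_inj. Qed.

Lemma continuous_subtype (Y : topologicalType) (f : Y -> pointed_subtype) :
  continuous (subtype_val \o f) -> continuous f.
Proof.
move=> cf; exact: (@continuous_comp_initial A Y T set_val f cf).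
Qed.

Lemma subtype_compact : compact A -> compact [set: pointed_subtype].
Proof.
move=> cA F FF _.
have [|p [Ap clp]] := cA (subtype_val @ F) _.
  by apply: (@filterS _ F _ setT); [move=> x _; exact: subtype_valP|exact: filterT].
have pA : p \in A by exact/mem_set.
exists (exist _ p pA); split=> // B C FB.
rewrite nbhsE => -[U [[W oW <-] /= Wp] UC].
have [|y [[x Bx <-] Wy]] := clp (subtype_val @` B) W _ (open_nbhs_nbhs (conj oW Wp)).
  by apply: (@filterS _ F _ B) => // x Bx; exists x.
by exists x; split=> //; apply: UC.
Qed.

Lemma subtype_hausdorff : hausdorff_space T -> hausdorff_space pointed_subtype.
Proof.
move=> hT x y clxy; apply: subtype_val_inj; apply: hT => B C nB nC.
have [z [Bz Cz]] := clxy _ _ (subtype_val_continuous nB) (subtype_val_continuous nC).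
by exists (subtype_val z).
Qed.

End PointedSubtype.

Section Closedness.
Variable T : topologicalType.

Lemma closed_forall (I : Type) (P : I -> set T) :
  (forall i, closed (P i)) -> closed [set x | forall i, P i x].
Proof.
move=> cP; rewrite (_ : mkset _ = \bigcap_i P i); first exact: closed_bigI.
by apply/seteqP; split => x /= h i; [move=> _|]; exact: h.
Qed.

Lemma closed_imply (Q : Prop) (P : set T) : closed P -> closed [set x | Q -> P x].
Proof. by move=> cP; apply: closed_forall. Qed.

Lemma closed_le_fun (R : realType) (f : T -> R) (c : R) :
  continuous f -> closed [set x | f x <= c].
Proof. by move=> cf; exact: (iffLR (continuous_closedP f) cf _ (@closed_le R c)). Qed.

End Closedness.

Section CocycleSpace.
Variables (R : realType) (G : topologicalGroupType).
Variables (S : seq G) (V : nat -> set G) (j d : R).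
Hypothesis V1 : forall k, nbhs 1%g (V k).
Hypothesis VJ : forall k g u, V k u -> V k (u ^ g)%g.
Hypothesis S_sym : perm_eq [seq s^-1%g | s <- S] S.

Local Notation T := (prod_topology (fun _ : G * G => R)).
Implicit Types (f : T) (a g s u : G).

(* The bounded, equicontinuous families [f (s, _)] that behave like the increments
   [L (s g) - L g] of a function [L] on [G]. *)
Definition cocycles : set T := [set f |
  [/\ forall i, `|f i| <= j,
      forall s g u k, V k u -> `|f (s, g * u)%g - f (s, g)| <= j / k.+1%:R &
      forall s g, s \in S -> f (s^-1%g, g) = - f (s, (s^-1 * g)%g)]].

Definition decreasing_at g : set T := [set f | \sum_(s <- S) f (s, g) <= - d].

Let ev (i : G * G) (f : T) : R := f i.

Let ev_cont i : continuous (ev i).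
Proof. exact: (@eval_continuous (G * G)%type (fun=> R) i). Qed.

Let closed_abs (h : T -> R) (c : R) : continuous h -> closed [set f | `|h f| <= c].
Proof.
move=> ch; apply: (@closed_le_fun _ _ (fun f => `|h f|)) => f.
exact: (cvg_norm (ch f)).
Qed.

Lemma cocycles_closed : closed cocycles.
Proof.
rewrite (_ : cocycles = [set f | forall i, `|f i| <= j] `&`
  [set f | forall s g u k, V k u -> `|f (s, g * u)%g - f (s, g)| <= j / k.+1%:R] `&`
  [set f | forall s g, s \in S -> `|f (s^-1%g, g) + f (s, (s^-1 * g)%g)| <= 0]); last first.
  apply/seteqP; split=> f /=.
    by move=> [h1 h2 h3]; split=> // s g sS; rewrite h3 // addNr normr0.
  move=> [[h1 h2] h3]; split=> // s g sS; apply/eqP.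
  by rewrite -addr_eq0 -normr_le0 h3.
apply: closedI; first apply: closedI.
- by apply: closed_forall => i; apply: (@closed_abs (ev i)); exact: ev_cont.
- apply: closed_forall => s; apply: closed_forall => g; apply: closed_forall => u.
  apply: closed_forall => k; apply: closed_imply.
  apply: (@closed_abs (fun f => ev (s, g * u)%g f - ev (s, g) f)) => f.
  exact: (cvgB (@ev_cont (s, g * u)%g f) (@ev_cont (s, g) f)).
- apply: closed_forall => s; apply: closed_forall => g; apply: closed_imply.
  apply: (@closed_abs (fun f => ev (s^-1%g, g) f + ev (s, (s^-1 * g)%g) f)) => f.
  exact: (cvgD (@ev_cont (s^-1%g, g) f) (@ev_cont (s, (s^-1 * g)%g) f)).
Qed.

Lemma cocycles_compact : compact cocycles.
Proof.
apply: (subclosed_compact cocycles_closed).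
  apply: (@tychonoff (G * G)%type (fun=> R) (fun=> `[- j, j]%classic)) => _.
  exact: segment_compact.
by move=> f [h _ _] i; rewrite /= in_itv /= -ler_norml.
Qed.

Lemma decreasing_closed g : closed (decreasing_at g).
Proof.
apply: (@closed_le_fun _ _ (fun f => \sum_(s <- S) ev (s, g) f)) => f.
exact: (@cvg_sum_seq R T G (nbhs f) _ S (fun s => ev (s, g)) (fun s => ev (s, g) f)
  (fun s => @ev_cont (s, g) f)).
Qed.

Definition decreasing_cocycles := cocycles `&` [set f | forall g, decreasing_at g f].

Lemma decreasing_cocycles_compact : compact decreasing_cocycles.
Proof.
apply: (subclosed_compact _ cocycles_compact); last by move=> f [].
by apply: closedI; [exact: cocycles_closed|apply: closed_forall; exact: decreasing_closed].
Qed.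

(** Finite intersection property: a cluster point of the solutions for finite [F] satisfies all the
    closed conditions at once. *)
Lemma decreasing_cocycles_nonempty :
  (forall F : seq G, exists2 f, cocycles f & forall g, g \in F -> decreasing_at g f) ->
  decreasing_cocycles !=set0.
Proof.
move=> hF; pose B (F : seq G) := cocycles `&` [set f | forall g, g \in F -> decreasing_at g f].
have BF : ProperFilter (filter_from setT B).
  apply: filter_from_proper => [|F _]; last by have [f cf hf] := hF F; exists f.
  apply: filter_fromT_filter; first by exists [::].
  move=> F F'; exists (F ++ F') => f [cf hf]; split; split=> // g gF; apply: hf.
    by rewrite mem_cat gF.
  by rewrite mem_cat gF orbT.
have [|f [cf clf]] := cocycles_compact BF.
  by exists [::] => // f [].
exists f; split=> // g; apply: (@decreasing_closed g) => C nC.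
have [|h [[_ hh] Ch]] := clf (B [:: g]) C _ nC; first by exists [:: g].
by exists h; split=> //; apply: hh; rewrite mem_head.
Qed.

(** Translation on the right commutes with the left multiplication in the cocycle relation, and
    gives a left action. *)
Definition translate a f : T := fun i => f (i.1, i.2 * a)%g.

Lemma translate_cocycles a f : cocycles f -> cocycles (translate a f).
Proof.
move=> [h1 h2 h3]; split=> [i|s g u k Vu|s g sS]; rewrite /translate /=.
- exact: h1.
(* Moving [u] past [a] replaces it by its conjugate [u ^ a]; the modulus of continuity survives
   because [V k] is invariant under conjugation. *)
- rewrite (_ : (g * u * a = g * a * (u ^ a))%g); last by rewrite conjgE !mulgA mulgK.
  by apply: h2; exact: VJ.
- by rewrite h3 // mulgA.
Qed.

Lemma translate_decreasing a f :
  decreasing_cocycles f -> decreasing_cocycles (translate a f).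
Proof.
by move=> [cf hf]; split; [exact: translate_cocycles|move=> g; exact: (hf (g * a)%g)].
Qed.

Section NonEmpty.
Variable x0 : decreasing_cocycles.

Local Notation X := (pointed_subtype x0).

Let coord (i : G * G) (x : X) : R := subtype_val x i.

Let coord_cont i : continuous (coord i).
Proof.
by move=> x; exact: (continuous_comp (@subtype_val_continuous _ _ x0 x) (@ev_cont i _)).
Qed.

Definition translate_sub a (x : X) : X :=
  exist _ (translate a (subtype_val x)) (mem_set (translate_decreasing a (subtype_valP x))).

Lemma translate_sub1 x : translate_sub 1%g x = x.
Proof.
apply: subtype_val_inj; apply: functional_extensionality_dep => -[s g] /=.
by rewrite -[LHS]/(subtype_val x (s, g * 1)%g) mulg1.
Qed.

Lemma translate_subM a b x : translate_sub (a * b)%g x = translate_sub a (translate_sub b x).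
Proof.
apply: subtype_val_inj; apply: functional_extensionality_dep => -[s g] /=.
rewrite -[LHS]/(subtype_val x (s, g * (a * b))%g).
by rewrite -[RHS]/(subtype_val x (s, g * a * b)%g) mulgA.
Qed.

(** Joint continuity rests on equicontinuity: replacing [a] by [b] multiplies the argument by
    [a^-1 * b] on the right, at a cost at most [j / k.+1%:R] for all cocycles simultaneously. *)
Lemma translate_sub_continuous : continuous (fun p : G * X => translate_sub p.1 p.2).
Proof.
apply: continuous_subtype; apply/continuous_prod => -[s g] [a x].
apply/cvgrPdist_lt => e e0.
have [k hk] : exists k, j / k.+1%:R < e / 2.
  have j1 : 0 < `|j| + 1 by rewrite ltr_wpDl.
  have e1 : 0 < e / 2 / (`|j| + 1) by rewrite !divr_gt0.
  have [k _ hk] := near_infty_natSinv_lt (PosNum e1).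
  exists k; have := hk k (leqnn k); rewrite /= ltr_pdivlMr // mulrC.
  by apply: le_lt_trans; rewrite ler_pM2r ?invr_gt0 // (le_trans (ler_norm j)) // lerDl.
have na : \forall b \near a, V k (a^-1 * b)%g.
  have cp : (fun b : G => (a^-1%g, b)) @ a --> (a^-1%g, a).
    by apply: cvg_pair; [exact: cvg_cst|exact: cvg_id].
  have := cvg_comp _ _ cp (@mulg_continuous G (a^-1%g, a)).
  by rewrite /= mulVg => /(_ _ (V1 k)).
have nx : \forall y \near x, `|coord (s, g * a)%g x - coord (s, g * a)%g y| < e / 2.
  by have /cvgrPdist_lt := @coord_cont (s, g * a)%g x; apply; rewrite divr_gt0.
exists ([set b | V k (a^-1 * b)%g],
  [set y : X | `|coord (s, g * a)%g x - coord (s, g * a)%g y| < e / 2]).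
  by split.
move=> [b y] [/= Vb xy].
rewrite -[X in X < _]/(`|coord (s, g * a)%g x - coord (s, g * b)%g y|).
have -> : (g * b = g * a * (a^-1 * b))%g by rewrite mulgA mulgK.
have [[_ h _] _] := subtype_valP y; have := h s (g * a)%g _ _ Vb.
rewrite -[X in X <= _]/(`|coord (s, g * a * (a^-1 * b))%g y - coord (s, g * a)%g y|).
move: xy; set p := coord _ x; set q := coord _ y; set r := coord _ y => pq.
rewrite distrC => qr; have := ler_normD (p - q) (q - r); rewrite addrA subrK.
by move/le_lt_trans; apply; rewrite [e]splitr ltrD // (le_lt_trans qr).
Qed.

Definition translation_action : continuous_action G X :=
  ContinuousAction translate_sub1 translate_subM translate_sub_continuous.

(** At the identity, the cocycle relation says that the coordinate of [s^-1] is minus that of [s]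
    after translation by [s^-1]. An invariant mean therefore gives [m s^-1 = - m s], so the sum over
    the symmetric [S] is zero, while it should be at most [- d]. *)
Lemma decreasing_cocycles_not_amenable : 0 < d -> amenable R G -> False.
Proof.
move=> d0 /(_ X translation_action) [||mu [_ inv]].
- exact: subtype_compact decreasing_cocycles_compact.
- apply: subtype_hausdorff; apply: (@hausdorff_product (G * G)%type (fun=> R)) => _.
  exact: Rhausdorff.
pose F (s : G) : X -> R := coord (s, 1%g).
have cF s : continuous (F s) by exact: coord_cont.
have bF s x : `|F s x| <= j by have [[h _ _] _] := subtype_valP x; exact: h.
pose m s := Rintegral mu setT (F s).
have mV s : s \in S -> m s^-1%g = - m s.
  move=> sS.
  have ct : continuous (translate_sub s^-1%g).
    move=> x; have cc : (fun=> s^-1%g) @ nbhs x --> s^-1%g by exact: cvg_cst.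
    have ci : id @ nbhs x --> x by exact: cvg_id.
    have cp : (fun y : X => (s^-1%g, y) : G * X) @ nbhs x --> ((s^-1%g, x) : G * X).
      exact: (cvg_pair cc ci).
    exact: (cvg_comp _ _ cp (@translate_sub_continuous (s^-1%g, x))).
  have E : m s = Rintegral mu setT (F s \o translate_sub s^-1%g).
    by rewrite (@Rintegral_invariant _ _ mu _ _ j ct) //; exact: inv.
  rewrite E -mulN1r -RintegralZl //; last first.
    apply: (@bounded_integrable _ _ mu (F s \o translate_sub s^-1%g) j).
      by move=> x; apply: continuous_comp; [exact: ct|exact: cF].
    by move=> x; exact: bF.
  apply: eq_Rintegral => x _; rewrite mulN1r.
  have [[_ _ h] _] := subtype_valP (x : X); have := h s 1%g sS; rewrite mulg1 => h'.
  by rewrite -[RHS]/(- coord (s, 1 * s^-1)%g x) mul1g; exact: h'.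
have sum0 : \sum_(s <- S) m s = 0.
  have : \sum_(s <- S) m s = - \sum_(s <- S) m s.
    rewrite -{1}(perm_big _ S_sym) big_map -sumrN big_seq [RHS]big_seq.
    by apply: eq_bigr => s sS; exact: mV.
  by lra.
have := Rintegral_sum mu S cF (C := fun=> j) bF; rewrite sum0 => I0.
have : Rintegral mu setT (fun x => \sum_(s <- S) F s x) <= Rintegral mu setT (cst (- d)).
  apply: le_Rintegral => //.
  - apply: (@bounded_integrable _ _ mu (fun x => \sum_(s <- S) F s x) (\sum_(s <- S) j)).
      by move=> x; exact: (@cvg_sum_seq R X G (nbhs x) _ S F (fun s => F s x) (fun s => cF s x)).
    by move=> x; rewrite (le_trans (ler_norm_sum _ _ _)) // ler_sum.
  - apply: (@bounded_integrable _ _ mu (cst (- d)) `|d|); first exact: cst_continuous.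
    by move=> x; rewrite /= normrN.
  - by move=> x _; have [_ h] := subtype_valP (x : X); exact: h.
by rewrite I0 Rintegral_cst // [X in fine X](probability_setT mu) mulr1 oppr_ge0 leNgt d0.
Qed.

End NonEmpty.

End CocycleSpace.

(** * Every vector of every representation is compact *)

Section AllCompact.
Variables (R : realType) (G : topologicalGroupType).
Hypothesis sinG : SIN G.
Hypothesis amenableG : amenable R G.
Hypothesis strongTG : strong_property_T R G.

Section Increments.
Variables (H : hilbertType R) (pi : unitaryRep G H) (S : seq G) (z : H).
Variables (J : nat) (D : H -> R).
Hypothesis SV : forall s, s \in S -> s^-1%g \in S.
Hypothesis z1 : hnorm z = 1.
Hypothesis quad_D : quadratic D.
Hypothesis D_diff : forall s v, s \in S -> `|D (pi s v) - D v| <= J%:R * hnorm v ^+ 2.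

(** The value 0 outside [S] is needed because [cocycles] bounds all coordinates, whereas [D_diff]
    only controls those in [S]. *)
Definition increment : prod_topology (fun _ : G * G => R) := fun i =>
  if i.1 \in S then D (pi i.1 (pi i.2 z)) - D (pi i.2 z) else 0.

(** For fixed [s] the difference [E] is again a quadratic form, bounded by [J%:R], so
    [quadratic_modulus] applies between [pi g z] and [pi (g * u) z]. Their distance is that of [z]
    and [pi u z], hence independent of [g]. *)
Lemma increment_cocycle (V : nat -> set G) :
  (forall k u, V k u -> hnorm (z - pi u z) < k.+1%:R^-1) ->
  cocycles S V (7 * J%:R) increment.
Proof.
move=> hV; have J0 : 0 <= J%:R :> R by [].
split.
- move=> [s g]; rewrite /increment /=; case: ifP => sS; last by rewrite normr0 mulr_ge0.
  rewrite (le_trans (D_diff _ sS)) // rep_hnorm z1 expr1n mulr1; lra.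
- move=> s g u k Vu; rewrite /increment /=; case: ifP => sS; last first.
    by rewrite subrr normr0 divr_ge0 // mulr_ge0.
  pose E v := D (pi s v) - D v.
  have qE : quadratic E.
    move=> x y; rewrite /E linear_mapD; last exact: rep_linear.
    rewrite linear_mapB; last exact: rep_linear.
    by have := quad_D x y; have := quad_D (pi s x) (pi s y); lra.
  have := quadratic_modulus (v := pi g z) (b := pi (g * u)%g z - pi g z) (k := k.+1) qE.
  rewrite [pi g z + _]addrC subrK; apply=> //.
  + by move=> v; exact: D_diff.
  + by rewrite rep_hnorm z1.
  + by rewrite repM rep_hnormB hnormB; exact/ltW/hV.
- move=> s g sS; rewrite /increment /= SV // sS opprB.
  by rewrite [in RHS]repM repVK.
Qed.

End Increments.

(** The contrapositive of the Kazhdan condition, applied to [v] normalized. The constant is capped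
    at 1 as [hnorm_avg_le] requires. *)
Lemma strong_property_T_gap : exists (Q : seq G) (eps : R), [/\ 0 < eps, eps <= 1 &
  forall (K : hilbertType R) (rho : unitaryRep G K),
    (forall v, (forall g, rho g v = v) -> v = 0) ->
    forall v, v != 0 -> exists2 g, g \in Q & eps * hnorm v <= hnorm (v - rho g v)].
Proof.
have [Q0 finQ [eps e0 hK]] := strongTG.
have [Q QE] := iffLR (finite_seqP _) finQ.
exists Q, (Num.min eps 1); split; rewrite ?lt_min ?e0 ?ltr01 ?ge_min ?lexx ?orbT //.
move=> K rho noinv v v0; apply: contrapT => hn.
have vp := hnorm_gt0 v0.
have [|w w1 hw] := hK K rho.
  exists ((hnorm v)^-1%:C *: v).
    by rewrite norm_hnorm hnormZr ger0_norm ?invr_ge0 ?ltW // mulVf ?gt_eqF.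
  move=> g Qg; rewrite linear_mapZ; last exact: rep_linear.
  rewrite -scalerBr norm_hnorm ltcR hnormZr ger0_norm ?invr_ge0 ?(ltW vp) //.
  rewrite ltr_pdivrMl // mulrC ltNge; apply/negP => h; apply: hn.
  exists g; first by move: Qg; rewrite QE.
  by rewrite (le_trans _ h) // ler_pM2r // ge_min lexx.
by move: w1; rewrite (noinv w hw) normr0 => /eqP; rewrite eq_sym oner_eq0.
Qed.

Lemma all_vectors_compact (H : hilbertType R) (pi : unitaryRep G H) v :
  compact_vectors pi v.
Proof.
apply: contrapT => nv.
have [z z1 zM] := orthogonal_exists (@compact_vectors0 _ _ _ pi)
  (@compact_vectorsD _ _ _ pi) (@compact_vectorsZ _ _ _ pi)
  (@compact_vectors_closed _ _ _ pi) nv.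
have [Q [eps [eps0 eps1 gap]]] := strong_property_T_gap.
have [J [d [d0 hD]]] := exists_log_density eps0 eps1
  (gap _ (conj_rep (@compact_vectors_rep _ _ _ pi)) (@conj_rep_no_invariant _ _ _ pi)) z1 zM.
(* Continuity of the orbit of [z] gives neighbourhoods of the identity, and the SIN property shrinks
   them to conjugation-invariant ones. *)
have /choice [V hV] : forall k : nat, exists V : set G,
    [/\ nbhs 1%g V, forall u, V u -> hnorm (z - pi u z) < k.+1%:R^-1 &
        forall g x, V x -> V (x ^ g)%g].
  move=> k; have k0 : 0 < k.+1%:R^-1 :> R by rewrite invr_gt0.
  have := rep_near pi 1%g z k0; rewrite rep1 => /sinG[V [V1 VU VJ]].
  by exists V; split=> // u /VU.
have [f hf] : decreasing_cocycles (symgen Q) V (7 * J%:R) d !=set0.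
  apply: decreasing_cocycles_nonempty => F.
  have [D [qD dD sD]] := hD F; exists (increment pi (symgen Q) z D).
    apply: increment_cocycle => //; first exact: symgenV.
    by move=> k u Vu; have [_ h _] := hV k; exact: h.
  move=> g gF; rewrite /decreasing_at /= (le_trans _ (sD g gF)) //.
  by rewrite big_seq [leRHS]big_seq ler_sum // => s sS; rewrite /increment /= sS.
apply: (@decreasing_cocycles_not_amenable R G (symgen Q) V (7 * J%:R) d _ _ _
  (exist _ f (mem_set hf))) => //.
- by move=> k; have [] := hV k.
- by move=> k g u; have [_ _] := hV k; apply.
- exact: symgen_perm.
Qed.

End AllCompact.

(** * The compact hull *)

Section OrbitClosure.
Variables (R : realType) (H : hilbertType R).

Lemma ultra_seq (T I : Type) (F : set_system T) {UF : UltraFilter F} (l : seq H)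
    (P : H -> set T) : F [set a | exists2 y, y \in l & P y a] ->
  exists y, F (P y).
Proof.
elim: l => [|y l IH] Fl.
  by have [a [y]] := filter_ex Fl; rewrite in_nil.
have [Py|nPy] := in_ultra_setVsetC (P y) UF; first by exists y.
apply: IH; apply: filterS (filterI Fl nPy) => a [[x]].
by rewrite inE => /orP[/eqP->|xl] Px nP; [case: nP|exists x].
Qed.

(** An ultrafilter on a totally bounded set contains one ball of each finite cover, hence is Cauchy
    and converges by completeness. *)
Lemma tbounded_closure_compact (A : set H) : tbounded A ->
  (forall v, (forall e : R, 0 < e -> exists2 w, A w & hnorm (v - w) < e) -> A v) ->
  compact A.
Proof.
move=> tA clA; rewrite compact_ultra => F UF FA.
have [x hx] : exists x : H, F --> x.
  apply: hilbert_cauchy => e e0; have e2 : 0 < e / 2 by rewrite divr_gt0.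
  have [l hl] := tA _ e2.
  have [|y Fy] := @ultra_seq H H F UF l (fun y => [set a | hnorm (a - y) < e / 2]).
    by apply: filterS FA => a /hl.
  exists [set a | hnorm (a - y) < e / 2] => // a b /= ha hb.
  by rewrite (le_lt_trans (hnormDB _ y _)) // (hnormB y) [e]splitr ltrD.
exists x; split=> //; apply: clA => e e0.
have h2 : \forall w \near F, hnorm (x - w) < e by move/cvg_hnormP: hx; apply.
by have [w [Aw xw]] := filter_ex (filterI FA h2); exists w.
Qed.

End OrbitClosure.

Section CompactHull.
Variables (R : realType) (G : topologicalGroupType) (I : Type).
Variables (H : I -> hilbertType R) (pi : forall i, unitaryRep G (H i)).
Hypothesis pi_compact : forall i v, compact_vectors (pi i) v.

Local Notation W := {classic bool * {i : I & H i}}.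
Let fiber (w : W) : topologicalType := H (projT1 (w : bool * {i : I & H i}).2).
Local Notation T := (prod_topology fiber).

Let at_ (f : T) (b : bool) i (v : H i) : H i := f (b, existT (fun i => H i : Type) i v).

Definition orbit_closure i (v : H i) : set (H i) :=
  [set w | forall e : R, 0 < e -> exists g, hnorm (w - pi i g v) < e].

Lemma orbit_closure_compact i (v : H i) : compact (orbit_closure v).
Proof.
apply: tbounded_closure_compact.
  apply: tbounded_approx => e e0; exists (range (fun g => pi i g v)); first exact: pi_compact.
  by move=> w /(_ e e0)[g hg]; exists (pi i g v) => //; exists g.
move=> w hw e e0; have e2 : 0 < e / 2 by rewrite divr_gt0.
have [w' /(_ _ e2)[g hg] ww'] := hw _ e2; exists g.
by rewrite (le_lt_trans (hnormDB _ w' _)) // [e]splitr ltrD.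
Qed.

(* A point of the hull is a fibrewise isometry of the disjoint union of the [H i]
   (its values at [b = true]) together with its inverse (at [b = false]). *)
Definition hull : set T := [set f |
  [/\ forall b i (v w : H i), hnorm (at_ f b v - at_ f b w) <= hnorm (v - w),
      forall b i (v : H i), at_ f b (at_ f (~~ b) v) = v &
      forall b i (v : H i), orbit_closure v (at_ f b v)]].

Let at_cont b i (v : H i) : continuous (fun f => at_ f b v).
Proof. exact: (@eval_continuous W fiber (b, existT (fun i => H i : Type) i v)). Qed.

Let at_near f b i (v : H i) (e : R) : 0 < e -> \forall g \near f, hnorm (at_ f b v - at_ g b v) < e.
Proof.
move=> e0; exact: (@cvg_hnorm_near R (H i) T (nbhs f) _ (fun g => at_ g b v) _ e
  (@at_cont b i v f) e0).
Qed.

Let hnorm_small i (v w : H i) : (forall e : R, 0 < e -> hnorm (v - w) <= e) -> v = w.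
Proof.
move=> h; apply/eqP; rewrite -subr_eq0; apply/eqP/hnorm_eq0/eqP; rewrite eq_le hnorm_ge0 andbT.
by apply/ler_addgt0Pr => e e0; rewrite add0r; exact: h.
Qed.

Lemma hull_closed : closed hull.
Proof.
move=> f clf; split=> [b i v w|b i v|b i v].
- apply/ler_addgt0Pr => e e0; have e2 : 0 < e / 2 by rewrite divr_gt0.
  have [g [[hg _ _] [h1 h2]]] := clf _ (filterI (at_near f b v e2) (at_near f b w e2)).
  have := hnormDB (at_ f b v) (at_ g b v) (at_ f b w).
  have := hnormDB (at_ g b v) (at_ g b w) (at_ f b w).
  have := hg b i v w; rewrite (hnormB (at_ g b w) (at_ f b w)); move: h1 h2.
  by move: (hnorm _) (hnorm _) (hnorm _) (hnorm _) (hnorm _) (hnorm _) => *; lra.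
- apply: hnorm_small => e e0; have e2 : 0 < e / 2 by rewrite divr_gt0.
  (* The inner value [at_ f (~~ b) v] moves with [f]. It is therefore held fixed as a second
     evaluation point, and contractivity of [g] replaces it by [at_ g (~~ b) v]. *)
  have [g [[hg ig _] [h1 h2]]] := clf _
    (filterI (at_near f (~~ b) v e2) (at_near f b (at_ f (~~ b) v) e2)).
  have := hnormDB (at_ f b (at_ f (~~ b) v)) (at_ g b (at_ f (~~ b) v)) v.
  have := hg b i (at_ f (~~ b) v) (at_ g (~~ b) v); rewrite ig; move: h1 h2.
  by move: (hnorm _) (hnorm _) (hnorm _) (hnorm _) => *; lra.
- move=> e e0; have e2 : 0 < e / 2 by rewrite divr_gt0.
  have [g [[_ _ og] h1]] := clf _ (at_near f b v e2).
  have [a ha] := og b i v _ e2; exists a.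
  by rewrite (le_lt_trans (hnormDB _ (at_ g b v) _)) // [e]splitr ltrD.
Qed.

Lemma hull_compact : compact hull.
Proof.
apply: (subclosed_compact hull_closed).
  exact: (@tychonoff W fiber (fun w => orbit_closure (projT2 w.2))
    (fun w => @orbit_closure_compact _ _)).
by move=> f [_ _ h] [b [i v]]; exact: h.
Qed.

(** At [b = false] the order is reversed, since those values describe the inverse map. *)
Definition comp_fun (f g : T) : T := fun w =>
  let: (b, existT i v) := w in
  if b then at_ f true (at_ g true v) else at_ g false (at_ f false v).
(** Carrying the inverse along makes inversion a mere swap of coordinates, continuous for the
    product topology, and keeps bijectivity a closed condition. *)
Definition inv_fun (f : T) : T := fun w =>
  let: (b, existT i v) := w in at_ f (~~ b) v.
Definition one_fun : T := fun w => let: (b, existT i v) := w in v.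

Lemma hull_orbit f b i (v w : H i) : hull f -> orbit_closure v w -> orbit_closure v (at_ f b w).
Proof.
move=> [isof _ of_] vw e e0; have e2 : 0 < e / 2 by rewrite divr_gt0.
have [g hg] := vw _ e2; have [a ha] := of_ b i (pi i g v) _ e2.
exists (a * g)%g; rewrite repM (le_lt_trans (hnormDB _ (at_ f b (pi i g v)) _)) //.
by rewrite [e]splitr ltrD // (le_lt_trans (isof _ _ _ _)).
Qed.

Lemma hull_comp f g : hull f -> hull g -> hull (comp_fun f g).
Proof.
move=> hf hg; have [f1 f2 f3] := hf; have [g1 g2 g3] := hg; split.
- move=> [] i v w; first exact: le_trans (f1 _ _ _ _) (g1 _ _ _ _).
  exact: le_trans (g1 _ _ _ _) (f1 _ _ _ _).
- move=> [] i v; rewrite /at_ /=.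
    by have -> := g2 true i (at_ f false v); exact: f2.
  by have -> := f2 false i (at_ g true v); exact: g2.
- move=> [] i v; first exact: (@hull_orbit f true i v _ hf (g3 true i v)).
  exact: (@hull_orbit g false i v _ hg (f3 false i v)).
Qed.

Lemma hull_inv f : hull f -> hull (inv_fun f).
Proof.
move=> [f1 f2 f3]; split=> [b i v w|b i v|b i v]; [exact: f1| |exact: f3].
by rewrite /at_ /=; exact: f2.
Qed.

Lemma hull_one : hull one_fun.
Proof.
split=> // b i v e e0; exists 1%g; rewrite rep1 -[X in hnorm X]/(v - v).
by rewrite subrr hnorm0.
Qed.

Definition hull_group : Type := set_type hull.

HB.instance Definition _ := Topological.copy hull_group (set_type hull).
HB.instance Definition _ := gen_eqMixin hull_group.
HB.instance Definition _ := gen_choiceMixin hull_group.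

Definition hull_val (x : hull_group) : T := set_val (x : hull).

Lemma hull_valP x : hull (hull_val x). Proof. exact: set_valP. Qed.

Definition hull_mul (x y : hull_group) : hull_group :=
  exist _ (comp_fun (hull_val x) (hull_val y)) (mem_set (hull_comp (hull_valP x) (hull_valP y))).
Definition hull_invg (x : hull_group) : hull_group :=
  exist _ (inv_fun (hull_val x)) (mem_set (hull_inv (hull_valP x))).
Definition hull_oneg : hull_group := exist _ one_fun (mem_set hull_one).

Lemma hull_val_inj (x y : hull_group) :
  (forall b i (v : H i), at_ (hull_val x) b v = at_ (hull_val y) b v) -> x = y.
Proof.
move=> h; apply: val_inj; apply: functional_extensionality_dep => -[b [i v]].
exact: h.
Qed.

Lemma hull_mulA : associative hull_mul.
Proof. by move=> x y z; apply: hull_val_inj => -[] i v. Qed.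
Lemma hull_mul1g : left_id hull_oneg hull_mul.
Proof. by move=> x; apply: hull_val_inj => -[] i v. Qed.
Lemma hull_mulg1 : right_id hull_oneg hull_mul.
Proof. by move=> x; apply: hull_val_inj => -[] i v. Qed.
Lemma hull_mulVg : left_inverse hull_oneg hull_invg hull_mul.
Proof.
move=> x; apply: hull_val_inj => b i v; have [_ h _] := hull_valP x.
by case: b; exact: (h false i v).
Qed.
Lemma hull_mulgV : right_inverse hull_oneg hull_invg hull_mul.
Proof.
move=> x; apply: hull_val_inj => b i v; have [_ h _] := hull_valP x.
by case: b; exact: (h true i v).
Qed.

HB.instance Definition _ := isGroup.Build hull_group
  hull_mulA hull_mul1g hull_mulg1 hull_mulVg hull_mulgV.

Lemma hull_val_continuous : continuous hull_val.
Proof. exact: initial_continuous. Qed.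

Definition coord b i (v : H i) (x : hull_group) : H i := at_ (hull_val x) b v.

Lemma coord_continuous b i (v : H i) : continuous (coord b v).
Proof.
move=> x; exact: (@continuous_comp hull_group T (H i) hull_val (fun f => at_ f b v) x
  (hull_val_continuous (x := x)) (@at_cont b i v (hull_val x))).
Qed.

Lemma coord_near x b i (v : H i) (e : R) : 0 < e ->
  \forall y \near x, hnorm (coord b v x - coord b v y) < e.
Proof.
move=> e0.
exact: (@cvg_hnorm_near R (H i) hull_group (nbhs x) _ (coord b v) _ e
  (@coord_continuous b i v x) e0).
Qed.

Lemma continuous_hull (Y : topologicalType) (f : Y -> hull_group) :
  (forall b i (v : H i), continuous (fun y => coord b v (f y))) -> continuous f.
Proof.
move=> h; apply: (@continuous_comp_initial hull Y T set_val f).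
by apply/(@continuous_prod W fiber) => -[b [i v]]; exact: (h b i v).
Qed.

Lemma coord_le b i (v w : H i) x : hnorm (coord b v x - coord b w x) <= hnorm (v - w).
Proof. by have [h _ _] := hull_valP x; exact: h. Qed.

(** Composition is jointly continuous for pointwise convergence because the maps of the hull do not
    increase distances, uniformly in [x]. *)
Lemma coord_comp_near (h1 h2 : bool) i (v : H i) (x y : hull_group) (e : R) : 0 < e ->
  \forall p \near (x, y),
    hnorm (coord h1 (coord h2 v y) x - coord h1 (coord h2 v p.2) p.1) < e.
Proof.
move=> e0; have e2 : 0 < e / 2 by rewrite divr_gt0.
exists ([set x' | hnorm (coord h1 (coord h2 v y) x - coord h1 (coord h2 v y) x') < e / 2],
        [set y' | hnorm (coord h2 v y - coord h2 v y') < e / 2]).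
  by split; exact: coord_near.
move=> [x' y'] [/= hx hy]; rewrite (le_lt_trans (hnormDB _ (coord h1 (coord h2 v y) x') _)) //.
by rewrite [e]splitr ltrD // (le_lt_trans (coord_le _ _ _ _)).
Qed.

Lemma hull_mul_continuous :
  continuous (fun p : hull_group * hull_group => (p.1 * p.2)%g).
Proof.
apply: continuous_hull => b i v [x y]; apply/cvg_hnormP => e e0.
case: b; first exact: (@coord_comp_near true true i v x y e e0).
have [[A B] [/= nA nB] AB] := @coord_comp_near false false i v y x e e0.
by exists (B, A) => // -[x' y'] [/= Bx Ay]; exact: (AB (y', x')).
Qed.

Lemma hull_inv_continuous : continuous (fun x : hull_group => x^-1%g).
Proof. by apply: continuous_hull => b i v; exact: (@coord_continuous (~~ b) i v). Qed.

HB.instance Definition _ :=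
  isTopologicalGroup.Build hull_group hull_mul_continuous hull_inv_continuous.

Lemma hull_group_hausdorff : hausdorff_space hull_group.
Proof.
apply: (@subtype_hausdorff T hull hull_oneg); apply: (@hausdorff_product W fiber) => w.
exact: hilbert_hausdorff.
Qed.

Lemma hull_group_compact : compact [set: hull_group].
Proof. exact: (@subtype_compact T hull hull_oneg hull_compact). Qed.

Definition orbit_fun g : T := fun w =>
  let: (b, existT i v) := w in pi i (if b then g else g^-1%g) v.

Lemma orbit_hull g : hull (orbit_fun g).
Proof.
split=> [b i v w|b i v|b i v e e0].
- by rewrite /at_ /= rep_hnormB.
- by case: b; rewrite /at_ /= ?repVK ?repK.
- by exists (if b then g else g^-1%g); rewrite /at_ /= subrr hnorm0.
Qed.

Definition to_hull g : hull_group := exist _ (orbit_fun g) (mem_set (orbit_hull g)).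

Lemma coord_to_hull b i (v : H i) g :
  coord b v (to_hull g) = pi i (if b then g else g^-1%g) v.
Proof. by []. Qed.

Lemma to_hullM : {morph to_hull : g h / (g * h)%g}.
Proof.
move=> g h; apply: hull_val_inj => b i v.
rewrite -[LHS]/(pi i (if b then (g * h)%g else (g * h)^-1%g) v).
by case: b; rewrite ?invgM repM.
Qed.

Lemma to_hull_continuous : continuous to_hull.
Proof.
apply: continuous_hull => -[] i v; first exact: rep_orbit_continuous.
move=> g; exact: (@continuous_comp G G (H i) (fun h => h^-1%g) (fun h => pi i h v) g
  (@invg_continuous G g) (@rep_orbit_continuous _ _ _ (pi i) v g^-1%g)).
Qed.

Hypothesis pi_separates : forall (C : set G) g, closed C -> ~ C g ->
  exists i, ~ closure (pi i @` C) (pi i g).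

(** Separation is applied to the closed singleton of [h]: if [g] and [h] have the same image, no
    representation separates them. *)
Lemma to_hull_inj : hausdorff_space G -> injective to_hull.
Proof.
move=> hG g h gh; apply: contrapT => ngh.
have c1 : closed [set h] by apply: accessible_closed_set1; exact: hausdorff_accessible.
have [k ncl] := pi_separates c1 ngh; apply: ncl; apply: subset_closure; exists h => //.
apply: functional_extensionality_dep => v.
by have := congr1 (coord true v) gh; rewrite !coord_to_hull.
Qed.

(** Each point [g] of an open [U] is separated from the complement of [U] by some representation
    [pi i]. The neighbourhood of [pi i g] that witnesses this pulls back to the hull through the
    coordinates with [b = true]. *)
Lemma to_hull_open : @open G = @open (initial_topology to_hull).
Proof.
apply/seteqP; split=> U.
  (* [N] is the largest open subset of the hull with preimage inside [U], so no choice of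
     neighbourhoods is made. *)
  move=> oU; pose N := \bigcup_(D in [set D : set hull_group | open D /\ to_hull @^-1` D `<=` U]) D.
  exists N; first by apply: bigcup_open => D -[].
  apply/seteqP; split=> [g [D [_ DU] Dg]|g Ug]; first exact: DU.
  have [i ncl] := pi_separates (open_closedC oU) (fun h : (~` U) g => h Ug).
  have [B nB BC] : exists2 B : set {ptws H i -> H i}, nbhs (pi i g) B &
      forall h, B (pi i h) -> U h.
    apply: contrapT => hn; apply: ncl => B nB; apply: contrapT => hB; apply: hn.
    exists B => // h Bh; apply: contrapT => Uh; apply: hB.
    by exists (pi i h); split=> //; exists h.
  have pc : continuous (fun x : hull_group => (fun v => coord true v x) : {ptws H i -> H i}).
    by apply/continuous_prod => v; exact: coord_continuous.
  have := pc (to_hull g) B nB; rewrite /= nbhsE => -[D [oD Dg] DB].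
  by exists D => //; split=> // h Dh; apply: BC; exact: (DB _ Dh).
by move=> [D oD <-]; exact: (iffLR (continuousP to_hull) to_hull_continuous D oD).
Qed.

End CompactHull.

Theorem theorem1p2 (R : realType) (G : topologicalGroupType)
    (hausdorffG : hausdorff_space G)
    (sinG : SIN G)
    (sepG : unitary_reps_separate R G)
    (amenableG : amenable R G)
    (strongTG : strong_property_T R G) :
  precompact_group G.
Proof.
(* One representation for each closed set and point outside it is enough. The index type then lives
   at the level of [G], and not of all Hilbert spaces, so that the product over it can be formed. *)
pose I := {p : set G * G | closed p.1 /\ ~ p.1 p.2}.
pose rep := {H : hilbertType R & unitaryRep G H}.
have sep (p : I) : exists r : rep, ~ closure (projT2 r @` (sval p).1) (projT2 r (sval p).2).
  case: p => -[C g] /= [cC nCg]; have [H [pi h]] := sepG C g cC nCg.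
  by exists (existT _ H pi).
have [r hr] := choice sep.
pose pi i := projT2 (r i).
have pi_compact i v : compact_vectors (pi i) v by exact: all_vectors_compact.
have pi_separates C g : closed C -> ~ C g -> exists i, ~ closure (pi i @` C) (pi i g).
  by move=> cC nCg; exists (exist _ (C, g) (conj cC nCg)); exact: hr.
exists (hull_group pi), (to_hull pi); split.
- exact: hull_group_hausdorff.
- exact: hull_group_compact.
- split; [exact: to_hullM|exact: to_hull_inj|exact: to_hull_open].
Qed.
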